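(* Let $n\ge1$, $\mu=(1,2,\dots,n)$, and let $\eta$ be the singularity of a fully critical $\mu$-point, i.e. $\eta=(\eta^{(1)},\dots,\eta^{(n)})$ is a refinement of $\mu$ with $\eta^{(k)}$ a composition of $k$ with weakly decreasing parts for $k<n$ and $\eta^{(n)}=1^n$. Then the $B_\eta$-lattice $L_\eta$ is a $U(\mathfrak{gl}(n,\mathbb C))$-submodule of $V_K$.
   Context: Index sets and groups. $\mu=(1,2,\dots,n)$, $\Sigma(\mu)=\{(k,i)\mid 1\le i\le k\le n\}$; the group $S_\mu=S_1\times\cdots\times S_n$ acts on $\Sigma(\mu)$, $S_k$ permuting $\{(k,1),\dots,(k,k)\}$, and on families $z=(z_{k,i})$ by $(\sigma z)_{\sigma(k,i)}=z_{k,i}$. $\mathbb Z^\mu_0$ is the set of integer families $z=(z_{k,i})_{(k,i)\in\Sigma(\mu)}$ with $z_{n,i}=0$ for all $i$. $\delta^{k,i}$ is the family with $1$ in position $(k,i)$ and $0$ elsewhere. $\mathbb C[X_\mu]$ is the polynomial ring in $x_{k,i}$, $(k,i)\in\Sigma(\mu)$, and $K=\mathbb C(X_\mu)$ its fraction field; $S_\mu$ acts by $\sigma(x_{k,i})=x_{\sigma(k,i)}$, and for $f\in K$, $z\in\mathbb Z_0^\mu$, $f(x+z)$ is obtained by substituting $x_{k,i}\mapsto x_{k,i}+z_{k,i}$. A refinement $\eta=(\eta^{(1)},\dots,\eta^{(n)})$ of $\mu$ consists of compositions $\eta^{(k)}$ of $k$; it splits each row $\{(k,1),\dots,(k,k)\}$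 into consecutive intervals of sizes the parts of $\eta^{(k)}$, called $\eta$-blocks. $1^n=(1,\dots,1)$ ($n$ ones). $S_\eta\subset S_\mu$ is the subgroup preserving each $\eta$-block, $\eta!=|S_\eta|$; its simple transpositions are those exchanging two consecutive positions $(k,i),(k,i+1)$ of a same $\eta$-block. The big module. $V_K$ is the $K$-vector space with basis $\{T(z)\mid z\in\mathbb Z^\mu_0\}$, with $S_\mu$ acting by $\sigma(fT(z))=\sigma(f)T(\sigma(z))$. For $1\le i\le k<n$ put $$e^+_{k,i}=\frac{\prod_{j=1}^{k+1}(x_{k,i}-x_{k+1,j})}{\prod_{j\ne i}(x_{k,i}-x_{k,j})},\qquad e^-_{k,i}=\frac{\prod_{j=1}^{k-1}(x_{k,i}-x_{k-1,j})}{\prod_{j\ne i}(x_{k,i}-x_{k,j})}.$$ It is known that $V_K$ is a module over $U=U(\mathfrak{gl}(n,\mathbb C))$, with $K$-linear and $S_\mu$-equivariant action given by $$E_{k,k+1}T(z)=-\sum_{i=1}^k e^+_{k,i}(x+z)\,T(z+\delta^{k,i}),\qquad E_{k+1,k}T(z)=\sum_{i=1}^k e^-_{k,i}(x+z)\,T(z-\delta^{k,i}),$$ $$E_{k,k}T(z)=\Big(\sum_{j=1}^k(x_{k,j}+z_{k,j})-\sum_{j=1}^{k-1}(x_{k-1,j}+z_{k-1,j})+k-1\Big)T(z).$$ Divided differences. For a simple transposition $s\in S_\eta$ exchanging $(k,i),(k,i+1)$, $\partial_s=\frac{1}{x_{k,i}-x_{k,i+1}}(\mathrm{id}-s)$,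 an element of the smash product $K\# S_\eta$ (product $f\sigma\cdot g\tau=f\sigma(g)\sigma\tau$), which acts on $K$ and on $V_K$. For $\sigma=s_1\cdots s_l$ a reduced decomposition, $\partial_\sigma=\partial_{s_1}\cdots\partial_{s_l}$ (independent of the decomposition). $\mathrm{sym}_\eta=\frac1{\eta!}\sum_{\sigma\in S_\eta}\sigma$ and $D_\sigma^\eta=\mathrm{sym}_\eta\cdot\partial_\sigma$. The lattice. $B\subset K$ is the localization of $\mathbb C[X_\mu]$ at all $x_{k,i}-x_{k,j}-a$ with $1\le i<j\le k<n$, $a\in\mathbb Z\setminus\{0\}$, and $B_\eta$ is the localization of $B$ at all $x_{k,i}-x_{k,j}$ with $k<n$ and $(k,i),(k,j)$ in different $\eta$-blocks. $L_\eta\subset V_K$ is the $B_\eta$-span of $\{D_\sigma^\eta T(z)\mid\sigma\in S_\eta,\ z\in\mathbb Z_0^\mu\}$. *)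

(* Defs.v *)
From HB Require Import structures.
From mathcomp Require Import all_boot all_order all_fingroup all_algebra.
From mathcomp Require Import monalg mpoly.

Set Implicit Arguments.
Unset Strict Implicit.
Unset Printing Implicit Defensive.

Import GRing.Theory.
Local Open Scope ring_scope.

(* Indices are zero-based: row k and position i of the text are the ordinals
   k - 1 and i - 1, so that the row [k : 'I_n] has [k.+1] positions. *)
Definition Sigma (n : nat) : finType := {k : 'I_n & 'I_k.+1}.

Definition row_of (n : nat) (p : Sigma n) : 'I_n := tag p.
Definition pos_of (n : nat) (p : Sigma n) : nat := tagged p.

Section Refinements.
Variable n : nat.

Definition is_composition (m : nat) (c : seq nat) : bool :=
  (sumn c == m) && (0%N \notin c).

Definition is_refinement (eta : 'I_n -> seq nat) : Prop :=
  forall k : 'I_n, is_composition k.+1 (eta k).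

Definition same_block (eta : 'I_n -> seq nat) (p q : Sigma n) : bool :=
  (row_of p == row_of q) &&
  (reshape_index (eta (row_of p)) (pos_of p)
     == reshape_index (eta (row_of q)) (pos_of q)).

(* S_mu acts faithfully on Sigma(mu), so it and its subgroups are taken inside
   the group of permutations of Sigma(mu). *)
Definition S_eta (eta : 'I_n -> seq nat) : {set {perm Sigma n}} :=
  [set s : {perm Sigma n} | [forall p, same_block eta p (s p)]].

(* The simple transposition tperm p q of S_eta, encoded as the pair (p, q). *)
Definition simple_transposition (eta : 'I_n -> seq nat)
    (pq : Sigma n * Sigma n) : bool :=
  same_block eta pq.1 pq.2 && (pos_of pq.2 == (pos_of pq.1).+1).

(* The composite s_1 \o ... \o s_l.  The product of {perm _} composes in the
   opposite order: (s * t)%g x = t (s x). *)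
Definition word_perm (w : seq (Sigma n * Sigma n)) : {perm Sigma n} :=
  foldr (fun pq s => (s * tperm pq.1 pq.2)%g) 1%g w.

Definition reduced_decomposition (eta : 'I_n -> seq nat)
    (s : {perm Sigma n}) (w : seq (Sigma n * Sigma n)) : Prop :=
  [/\ all (simple_transposition eta) w,
      word_perm w = s
    & forall w' : seq (Sigma n * Sigma n),
        all (simple_transposition eta) w' -> word_perm w' = s ->
        (size w <= size w')%N].

Definition top_zero (z : {ffun Sigma n -> int}) : bool :=
  [forall p : Sigma n, ((row_of p).+1 == n) ==> (z p == 0)].

Definition Zmu0 : choiceType := {z : {ffun Sigma n -> int} | top_zero z}.

Fact top_zero0 : top_zero 0.
Proof. by apply/forallP => p; rewrite ffunE eqxx implybT. Qed.

(* Only ever applied to families that do vanish on the top row, for which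
   [insubd] does not use its default value. *)
Definition to_Zmu0 (z : {ffun Sigma n -> int}) : Zmu0 :=
  insubd (Sub 0 top_zero0 : Zmu0) z.

Definition delta_family (p : Sigma n) : {ffun Sigma n -> int} :=
  [ffun q => (q == p)%:R].

(* (s z)_{s p} = z_p *)
Definition perm_family (s : {perm Sigma n}) (z : Zmu0) : Zmu0 :=
  to_Zmu0 [ffun p => \val z ((s^-1)%g p)].

End Refinements.

Section BigModule.
Variables (C : fieldType) (n : nat).

Definition Cpoly : idomainType := {mpoly C[#|Sigma n|]}.

Definition KX : fieldType := {fraction Cpoly}.

Definition xpoly (p : Sigma n) : Cpoly := 'X_(enum_rank p).

Definition inK (f : Cpoly) : KX := tofrac f.

Definition xK (p : Sigma n) : KX := inK (xpoly p).

Definition Cconst (c : C) : KX := inK (mpolyC _ c).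

(* The field endomorphism sending x_p to phi p; well defined when the
   substitution x_p |-> phi p is injective on polynomials, as it is in the two
   uses below. *)
Definition substKX (phi : Sigma n -> Cpoly) (f : KX) : KX :=
  let ev (g : Cpoly) : Cpoly :=
    comp_mpoly [tuple phi (enum_val i) | i < #|Sigma n|] g in
  inK (ev \n_(generic_quotient.repr f)) / inK (ev \d_(generic_quotient.repr f)).

Definition permKX (s : {perm Sigma n}) : KX -> KX :=
  substKX (fun p => xpoly (s p)).

Definition shiftKX (z : Zmu0 n) : KX -> KX :=
  substKX (fun p => xpoly p + (\val z p)%:~R).

(* The free KX-module on Zmu0 (the ring structure of a monoid algebra plays
   no role). *)
Definition VK : lmodType KX := {malg KX[Zmu0 n]}.

Definition basisT (z : Zmu0 n) : VK := mkmalgU z 1.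

Definition permVK (s : {perm Sigma n}) (v : VK) : VK :=
  \sum_(z <- finmap.enum_fset (monalg.msupp v))
    permKX s (monalg.mcoeff z v) *: basisT (perm_family s z).

Definition e_plus (p : Sigma n) : KX :=
  (\prod_(q | row_of q == (row_of p).+1 :> nat) (xK p - xK q)) /
  (\prod_(q | (row_of q == row_of p) && (q != p)) (xK p - xK q)).

Definition e_minus (p : Sigma n) : KX :=
  (\prod_(q | (row_of q).+1 == row_of p :> nat) (xK p - xK q)) /
  (\prod_(q | (row_of q == row_of p) && (q != p)) (xK p - xK q)).

(* The operators by which the smash product KX # S_eta acts on VK: its product
   acts by composition, so pdiff_word [:: s_1; ...; s_l] is the action of
   \partial_{s_1} ... \partial_{s_l}. *)
Definition pdiff (pq : Sigma n * Sigma n) (v : VK) : VK :=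
  (xK pq.1 - xK pq.2)^-1 *: (v - permVK (tperm pq.1 pq.2) v).

Definition pdiff_word (w : seq (Sigma n * Sigma n)) (v : VK) : VK :=
  foldr pdiff v w.

Definition sym_eta (eta : 'I_n -> seq nat) (v : VK) : VK :=
  (#|S_eta eta|%:R)^-1 *: \sum_(s in S_eta eta) permVK s v.

Definition localization (A D : KX -> Prop) (f : KX) : Prop :=
  exists (a : KX) (ds : seq KX),
    [/\ A a, forall d, d \in ds -> D d & f = a / \prod_(d <- ds) d].

Definition polynomials (f : KX) : Prop := exists g : Cpoly, f = inK g.

Definition B_ring : KX -> Prop :=
  localization polynomials (fun d =>
    exists (p q : Sigma n) (a : int),
      [/\ row_of p = row_of q, (pos_of p < pos_of q)%N,
          ((row_of p).+1 < n)%N, a != 0 & d = xK p - xK q - a%:~R]).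

Definition B_eta (eta : 'I_n -> seq nat) : KX -> Prop :=
  localization B_ring (fun d =>
    exists p q : Sigma n,
      [/\ row_of p = row_of q, ((row_of p).+1 < n)%N,
          ~~ same_block eta p q & d = xK p - xK q]).

Definition lin_span (A : KX -> Prop) (G : VK -> Prop) (v : VK) : Prop :=
  exists s : seq (KX * VK),
    (forall c, c \in s -> A c.1 /\ G c.2) /\ v = \sum_(c <- s) c.1 *: c.2.

(* The elements D_s T(z); since the divided difference of s does not depend on
   the reduced decomposition w of s, all of them may be allowed. *)
Definition D_T (eta : 'I_n -> seq nat) (v : VK) : Prop :=
  exists (s : {perm Sigma n}) (w : seq (Sigma n * Sigma n)) (z : Zmu0 n),
    [/\ s \in S_eta eta, reduced_decomposition eta s w
      & v = sym_eta eta (pdiff_word w (basisT z))].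

Definition L_eta (eta : 'I_n -> seq nat) : VK -> Prop :=
  lin_span (B_eta eta) (D_T eta).

End BigModule.

Section EnvelopingAlgebra.
Variables (C : fieldType) (n : nat).

Definition is_lie_map (A : algType C) (f : 'M[C]_n -> A) : Prop :=
  forall M N : 'M[C]_n, f (M *m N - N *m M) = f M * f N - f N * f M.

Definition is_universal_enveloping
    (U : algType C) (iota : {linear 'M[C]_n -> U}) : Prop :=
  is_lie_map iota /\
  forall (A : algType C) (f : {linear 'M[C]_n -> A}), is_lie_map f ->
    exists g : {lrmorphism U -> A},
      (forall M, g (iota M) = f M) /\
      (forall g' : {lrmorphism U -> A},
          (forall M, g' (iota M) = f M) -> g' =1 g).

End EnvelopingAlgebra.

Section UModule.
Variables (C : fieldType) (n : nat).
Variables (U : algType C) (iota : {linear 'M[C]_n -> U}).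
Variable act : U -> VK C n -> VK C n.

(* A U-module structure on VK by KX-linear maps. *)
Definition is_Klinear_module : Prop :=
  [/\ forall u (f : KX C n) v w, act u (f *: v + w) = f *: act u v + act u w,
      forall c u u' v, act (c *: u + u') v = Cconst n c *: act u v + act u' v,
      forall v, act 1 v = v
    & forall u u' v, act (u * u') v = act u (act u' v)].

Definition Eij (i j : 'I_n) : U := iota (delta_mx i j).

Definition gelfand_tsetlin_formulas : Prop :=
  [/\ forall (k l : 'I_n) (z : Zmu0 n), l = k.+1 :> nat ->
        act (Eij k l) (basisT C z) =
        - \sum_(p : Sigma n | row_of p == k)
            shiftKX z (e_plus C p) *: basisT C (to_Zmu0 (\val z + delta_family p)),
      forall (k l : 'I_n) (z : Zmu0 n), l = k.+1 :> nat ->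
        act (Eij l k) (basisT C z) =
        \sum_(p : Sigma n | row_of p == k)
            shiftKX z (e_minus C p) *: basisT C (to_Zmu0 (\val z - delta_family p))
    & forall (k : 'I_n) (z : Zmu0 n),
        act (Eij k k) (basisT C z) =
        (\sum_(p : Sigma n | row_of p == k) (xK C p + (\val z p)%:~R)
         - \sum_(p : Sigma n | (row_of p).+1 == k :> nat)
             (xK C p + (\val z p)%:~R)
         + (k : nat)%:R) *: basisT C z].

Definition is_submodule (L : VK C n -> Prop) : Prop :=
  [/\ L 0, forall v w, L v -> L w -> L (v + w)
    & forall u v, L v -> L (act u v)].

End UModule.

(* Main.v *)
(** For v in V_K put A(v) = sum over s in S_eta of s(v / Delta), where Delta is
    the product of all x_p - x_q over pairs p < q in a common eta-block.  Divided
    differences are self-adjoint for A, so that sym_eta d_w T(z) is a multiple of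
    A(d_{rev w}(Delta) T(z)).  The polynomials d_w(Delta) span the polynomial ring
    over the S_eta-invariants; hence L_eta is the B_eta-span of all A(f T(z)) with
    f in B_eta.
    A generator E of gl(n) commutes with S_eta, whence E A(f T(z)) = A(f E T(z)).
    Since A(s v) = sgn(s) A(v), the polynomial f may be taken antisymmetric under
    the stabilizer of z in S_eta.  Such an f is divisible by the factors x_p - x_q
    of the Gelfand-Tsetlin denominators that are not invertible in B_eta, so the
    coefficients of f E T(z) lie in B_eta. *)

From HB Require Import structures.
Require Import Defs.
From mathcomp Require Import all_boot all_order all_fingroup all_algebra.
From mathcomp Require Import reals complex.
From mathcomp Require Import boolp monalg mpoly zify ring.

Set Implicit Arguments.
Unset Strict Implicit.
Unset Printing Implicit Defensive.

Import GRing.Theory.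

(** * Permutations preserving blocks *)

(** The spanning step rests on a duality. By the nil-Coxeter relations, composing two divided
    differences gives the one of the product when lengths add and zero otherwise. Once D_{w0}(Delta)
    is known to be the constant |S_eta|, where w0 is the longest element, the polynomials D_{w0
    s^-1}(Delta) / |S_eta| are dual to the D_s of a given length and are killed by all longer ones;
    any polynomial can then be reduced by stripping off its longest nonzero divided differences. The
    constant comes from self-adjointness, which makes D_{w0} proportional to A on scalars, and from
    the coefficient of w0 in the expansion of D_{w0} over the group. Denominators in B_eta are
    handled by completing them to their norm over S_eta, which is invariant and still invertible.
    The passage from generators to all of U uses only the universal property. The combinatorics is
    done for any finite set with a block relation and a rank. Products of permutations compose from
    left to right, which reverses the order of the factors with respect to the usual formulas. *)

Lemma tperm_braid (I : finType) (a b c : I) : a != b -> b != c -> a != c ->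
  (tperm a b * (tperm b c * tperm a b) = tperm b c * (tperm a b * tperm b c))%g.
Proof.
move=> ab bc ac.
have := tpermJ b c (tperm a b); rewrite conjgE tpermV => ->.
have := tpermJ a b (tperm b c); rewrite conjgE tpermV => ->.
by rewrite !tpermL tpermR !tpermD // eq_sym.
Qed.

Lemma tperm_commute (I : finType) (a b c d : I) :
  a != c -> a != d -> b != c -> b != d ->
  (tperm a b * tperm c d = tperm c d * tperm a b)%g.
Proof.
move=> ac ad bc bd; apply/commgP/conjg_fixP.
by rewrite tpermJ !tpermD // eq_sym.
Qed.

Section BlockPermutations.
Variables (I : finType) (blk : rel I) (rk : I -> nat).
Hypothesis blkxx : reflexive blk.
Hypothesis blk_sym : forall p q, blk p q = blk q p.
Hypothesis blk_trans : transitive blk.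
Hypothesis rk_inj : forall p q, blk p q -> rk p = rk q -> p = q.
Hypothesis blk_convex :
  forall p q m, blk p q -> rk p < m < rk q -> exists2 r, blk p r & rk r = m.

(** A block is a chain of consecutive ranks: [rk] is injective on it and leaves no gaps. Hence
    [block_perms] is a product of symmetric groups, with the adjacent transpositions as simple
    reflections. *)
Definition adjacent (pq : I * I) :=
  blk pq.1 pq.2 && (rk pq.2 == (rk pq.1).+1).

Definition block_perms : {set {perm I}} := [set s : {perm I} | [forall p, blk p (s p)]].

Definition block_pairs : {set I * I} :=
  [set pq | blk pq.1 pq.2 && (rk pq.1 < rk pq.2)].

Definition inversions (s : {perm I}) : {set I * I} :=
  [set pq in block_pairs | rk (s pq.2) < rk (s pq.1)].

(** The inverse appears because words are extended by a transposition acting after [s]: this is the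
    condition for [s * tperm pq.1 pq.2] to be shorter than [s]. *)
Definition descent (s : {perm I}) (pq : I * I) :=
  rk ((s^-1)%g pq.2) < rk ((s^-1)%g pq.1).

Definition wperm (w : seq (I * I)) : {perm I} :=
  foldr (fun pq s => (s * tperm pq.1 pq.2)%g) 1%g w.

Local Notation G := block_perms.

Lemma block_permsP (s : {perm I}) : reflect (forall p, blk p (s p)) (s \in G).
Proof. by rewrite inE; apply: forallP. Qed.

Lemma block_perm1 : (1%g : {perm I}) \in G.
Proof. by apply/block_permsP => p; rewrite perm1. Qed.

Lemma block_permM s t : s \in G -> t \in G -> (s * t)%g \in G.
Proof.
move=> /block_permsP sG /block_permsP tG; apply/block_permsP => p.
by rewrite permM (blk_trans (sG p)).
Qed.

Lemma block_permV s : s \in G -> (s^-1)%g \in G.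
Proof.
move=> /block_permsP sG; apply/block_permsP => p.
by rewrite blk_sym; have := sG ((s^-1)%g p); rewrite permKV.
Qed.

Lemma block_tperm p q : blk p q -> tperm p q \in G.
Proof.
by move=> pq; apply/block_permsP => r; case: tpermP => [->|->|//];
   rewrite // blk_sym.
Qed.

Lemma blk_perm s p q : s \in G -> blk (s p) (s q) = blk p q.
Proof.
move=> /block_permsP sG; apply/idP/idP => h.
  by rewrite (blk_trans (sG p)) // (blk_trans h) // blk_sym.
by rewrite (blk_trans _ (blk_trans h (sG q))) // blk_sym.
Qed.

Lemma adjacent_perm pq : adjacent pq -> tperm pq.1 pq.2 \in G.
Proof. by case/andP => h _; apply: block_tperm. Qed.

Lemma wperm_block w : all adjacent w -> wperm w \in G.
Proof.
elim: w => [|pq w IH] /=; first by rewrite block_perm1.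
by case/andP => h /IH; move/block_permM; apply; apply: adjacent_perm.
Qed.

Lemma wperm_cat w w' : wperm (w ++ w') = (wperm w' * wperm w)%g.
Proof. by elim: w => [|pq w IH] /=; rewrite ?mulg1 // IH mulgA. Qed.

Lemma wperm_rev w : wperm (rev w) = ((wperm w)^-1)%g.
Proof.
elim: w => [|pq w IH]; first by rewrite /= invg1.
by rewrite rev_cons -cats1 wperm_cat IH /= mul1g invMg tpermV.
Qed.

Lemma rk_neq p q : blk p q -> p != q -> rk p != rk q.
Proof. by move=> h; apply: contraNN => /eqP /(rk_inj h) ->. Qed.

(** The counterpart of the fact that a simple reflection permutes the positive roots other than its
    own. It controls both the number of inversions and the sign of [Delta]. *)
Lemma rk_tperm a b u v : adjacent (a, b) -> blk u v -> (u, v) != (a, b) ->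
  rk u < rk v -> rk (tperm a b u) < rk (tperm a b v).
Proof.
case/andP => /= ab /eqP rab uv; rewrite xpair_eqE => ne lt.
case: (tpermP a b u) => [eu|eu|/eqP ua /eqP ub];
case: (tpermP a b v) => [ev|ev|/eqP va /eqP vb]; subst => //.
- lia.
- by rewrite !eqxx in ne.
- have bv : blk b v by rewrite (blk_trans _ uv) // blk_sym.
  have := rk_neq bv; rewrite eq_sym vb => /(_ isT); lia.
- lia.
- lia.
- lia.
- lia.
- have ua' : blk u a by rewrite (blk_trans uv) // blk_sym.
  have := rk_neq ua'; rewrite ua => /(_ isT).
  have := rk_neq uv; rewrite ub => /(_ isT); lia.
Qed.

Lemma rk_add_neq p q m : rk q = rk p + m.+1 -> p != q.
Proof. by move=> e; apply/eqP => e2; move: e; rewrite e2; lia. Qed.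

(** Exchanging two neighbours after [s] alters the order of the images of one pair only, namely the
    pair that [s] sends to these neighbours. *)
Lemma inversions_ascentE s pq : s \in G -> adjacent pq -> ~~ descent s pq ->
  let ab := ((s^-1)%g pq.1, (s^-1)%g pq.2) in
  inversions (s * tperm pq.1 pq.2) = ab |: inversions s /\ ab \notin inversions s.
Proof.
case: pq => a b /= sG ab; rewrite /descent /= => nd.
have [/= hab /eqP rab] := andP ab.
pose a' := (s^-1)%g a; pose b' := (s^-1)%g b.
have sa : s a' = a by rewrite permKV.
have sb : s b' = b by rewrite permKV.
have hab' : blk a' b' by rewrite -(blk_perm _ _ sG) sa sb.
have neab : a != b by apply/eqP => e; move: rab; rewrite e; exact: n_Sn.
have ltab : rk a' < rk b'.
  rewrite ltn_neqAle leqNgt nd andbT rk_neq //.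
  by apply: contraNneq neab => e; rewrite -sa -sb e.
split; last first.
  by rewrite !inE /= !permKV rab [_ < rk a]ltnNge leqnSn andbF.
apply/setP => -[u v]; rewrite [RHS]in_setU1 !inE /= !permM -/a' -/b'.
have [[-> ->]|ne] := eqVneq (u, v) (a', b').
  by rewrite hab' ltab sa sb tpermL tpermR rab ltnS leqnn.
case: (boolP (blk u v)) => //= uv; case: (boolP (rk u < rk v)) => //= luv.
have suv : blk (s u) (s v) by rewrite blk_perm.
have svu : blk (s v) (s u) by rewrite blk_sym.
have neq : u != v by apply/eqP => e; move: luv; rewrite e ltnn.
have sneq : s u != s v by rewrite (inj_eq perm_inj).
apply/idP/idP => lt.
  rewrite ltnNge; apply/negP => le.
  have: rk (s u) < rk (s v) by rewrite ltn_neqAle le andbT rk_neq.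
  move/(rk_tperm ab suv) => H.
  have: (s u, s v) != (a, b).
    apply: contraNneq ne => -[e1 e2]; apply/eqP; congr (_, _);
      by apply: (@perm_inj _ s); rewrite ?sa ?sb.
  by move/H; rewrite ltnNge (ltnW lt).
apply: rk_tperm => //; apply/eqP => -[e1 e2].
have eu : u = b' by apply: (@perm_inj _ s); rewrite sb.
have ev : v = a' by apply: (@perm_inj _ s); rewrite sa.
by rewrite eu ev ltnNge (ltnW ltab) in luv.
Qed.

Lemma inversions_ascent s pq : s \in G -> adjacent pq -> ~~ descent s pq ->
  #|inversions (s * tperm pq.1 pq.2)| = #|inversions s|.+1.
Proof.
by move=> sG a nd; have [-> h] := inversions_ascentE sG a nd; rewrite cardsU1 h.
Qed.

Lemma descent_mul s pq : s \in G -> adjacent pq ->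
  descent (s * tperm pq.1 pq.2) pq = ~~ descent s pq.
Proof.
case: pq => a b /= sG; rewrite /adjacent /= => /andP[ab /eqP rab].
rewrite /descent /= invMg !permM tpermV tpermL tpermR -leqNgt ltn_neqAle.
have -> : rk ((s^-1)%g a) != rk ((s^-1)%g b).
  apply: rk_neq; first by rewrite blk_perm // block_permV.
  by rewrite (inj_eq perm_inj); apply/eqP => e; rewrite e in rab; lia.
by [].
Qed.

Lemma inversions_descent s pq : s \in G -> adjacent pq -> descent s pq ->
  #|inversions s| = #|inversions (s * tperm pq.1 pq.2)|.+1.
Proof.
move=> sG h d; rewrite -(@inversions_ascent _ pq) //.
- by rewrite -mulgA tperm2 mulg1.
- by rewrite block_permM // adjacent_perm.
- by rewrite descent_mul // d.
Qed.

(** A transitive relation has only to be checked on neighbours, since convexity of the blocks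
    provides the intermediate points. *)
Lemma block_ind (P : I -> I -> Prop) :
  (forall p q, adjacent (p, q) -> P p q) ->
  (forall p q r, P p q -> P q r -> P p r) ->
  forall p q, blk p q -> rk p < rk q -> P p q.
Proof.
move=> Padj Ptr p q; move: {2}(rk q - rk p) (leqnn (rk q - rk p)) => m.
elim: m q => [|m IH] q le pq lt; first by lia.
have [e|ne] := eqVneq (rk q) (rk p).+1.
  by apply: Padj; rewrite /adjacent /= pq e eqxx.
have [||r pr er] := @blk_convex p q (rk q).-1 => //; first by lia.
have rq : blk r q by rewrite (blk_trans _ pq) // blk_sym.
apply: (Ptr _ r); first by apply: IH => //; lia.
by apply: Padj; rewrite /adjacent /= rq; apply/eqP; lia.
Qed.

(** Consider a point p below which everything in rank is fixed. Injectivity excludes that s p or the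
    preimage of p ranks below p; if both rank above p, the pair formed by p and its preimage
    violates monotonicity. *)
Lemma increasing_block_perm s : s \in G ->
  (forall p q, adjacent (p, q) -> rk (s p) < rk (s q)) -> s = 1%g.
Proof.
move=> sG inc.
have inc2 p q : blk p q -> rk p < rk q -> rk (s p) < rk (s q).
  by apply: (block_ind (P := fun p q => rk (s p) < rk (s q))) => // a b c;
     apply: ltn_trans.
apply/permP => p; rewrite perm1.
move: {2}(rk p).+1 (leqnn (rk p).+1) => m.
elim: m p => [//|m IH] p lt.
have psp := block_permsP _ sG p.
case: (ltngtP (rk (s p)) (rk p)) => [lt1|gt1|/esym/(rk_inj psp)<-//].
  by apply: (@perm_inj _ s); apply: IH; lia.
pose r := (s^-1)%g p; have sr : s r = p by rewrite permKV.
have rp : blk r p by have := block_permsP _ sG r; rewrite sr.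
case: (ltngtP (rk r) (rk p)) => [lt1|gt2|/(rk_inj rp) e].
- have := IH r; rewrite sr => e; move: (lt1); rewrite e ?ltnn //; lia.
- by move: (inc2 p r); rewrite sr blk_sym => /(_ rp gt2); lia.
- by rewrite -{1}e sr.
Qed.

Lemma exists_descent s : s \in G -> s != 1%g ->
  exists2 pq, adjacent pq & descent s pq.
Proof.
move=> sG ne.
have [/existsP[pq /andP[]]|/existsPn nd] :=
  boolP [exists pq, adjacent pq && descent s pq]; first by exists pq.
suff /invg_inj e : (s^-1 = 1^-1)%g by rewrite e eqxx in ne.
rewrite invg1; apply: increasing_block_perm; first exact: block_permV.
move=> p q h; have := nd (p, q); rewrite h /= /descent /= -leqNgt.
rewrite leq_eqVlt => /orP[/eqP e|//]; case/andP: h => /= h /eqP r.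
have/perm_inj e2 : (s^-1)%g p = (s^-1)%g q.
  by apply: rk_inj => //; rewrite blk_perm // block_permV.
by rewrite e2 in r; lia.
Qed.

Lemma inversions1 : #|inversions 1| = 0.
Proof.
apply: eq_card0 => -[u v]; rewrite !inE /= !perm1.
by case: ltngtP; rewrite ?andbF.
Qed.

Lemma size_word_ge w : all adjacent w -> #|inversions (wperm w)| <= size w.
Proof.
elim: w => [|pq w IH] /=; first by rewrite inversions1.
case/andP => h aw; have wG := wperm_block aw.
have [d|nd] := boolP (descent (wperm w) pq).
  apply: leq_trans (leqW (IH aw)); rewrite [leqRHS](inversions_descent wG h d).
  exact: leqnSn.
by rewrite inversions_ascent // ltnS IH.
Qed.

(** One reduced word is chosen for each permutation, with the number of inversions as fuel. The
    divided difference of a permutation is thus a function from the start, and independence of the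
    word becomes a lemma about it. *)
Fixpoint canonical_word_rec m (s : {perm I}) : seq (I * I) :=
  if m is m'.+1 then
    if [pick pq | adjacent pq && descent s pq] is Some pq then
      pq :: canonical_word_rec m' (s * tperm pq.1 pq.2)
    else [::]
  else [::].

Definition canonical_word s := canonical_word_rec #|inversions s| s.

Lemma canonical_word1 : canonical_word 1 = [::].
Proof. by rewrite /canonical_word inversions1. Qed.

Lemma canonical_wordS s : s \in G -> s != 1%g ->
  exists pq, [/\ adjacent pq, descent s pq &
    canonical_word s = pq :: canonical_word (s * tperm pq.1 pq.2)].
Proof.
move=> sG ne; have [pq0 a0 d0] := exists_descent sG ne.
rewrite /canonical_word (inversions_descent sG a0 d0) /=.
case: pickP => [pq /andP[a d]|/(_ pq0)]; last by rewrite a0 d0.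
exists pq; split => //; congr (_ :: canonical_word_rec _ _).
by apply: succn_inj; rewrite -!inversions_descent.
Qed.

Lemma inversions_ind (P : {perm I} -> Prop) :
  (forall s, s \in G ->
     (forall t, t \in G -> #|inversions t| < #|inversions s| -> P t) -> P s) ->
  forall s, s \in G -> P s.
Proof.
move=> H s; move: {2}#|inversions s|.+1 (leqnn #|inversions s|.+1) => m.
elim: m s => [//|m IH] s lt sG; apply: H => // t tG lt2; apply: IH => //; lia.
Qed.

Lemma canonical_wordP s : s \in G ->
  [/\ all adjacent (canonical_word s), wperm (canonical_word s) = s
    & size (canonical_word s) = #|inversions s|].
Proof.
move: s; apply: inversions_ind => s sG IH.
have [->|ne] := eqVneq s 1%g; first by rewrite canonical_word1 inversions1.
have [pq [a d ->]] := canonical_wordS sG ne.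
have [||h1 h2 h3] := IH (s * tperm pq.1 pq.2)%g.
- by rewrite block_permM // adjacent_perm.
- by rewrite [X in _ < X](inversions_descent sG a d).
by rewrite /= a h1 h2 h3 -mulgA tperm2 mulg1 (inversions_descent sG a d).
Qed.

(** * Operators satisfying the nil-Coxeter relations *)

Section NilCoxeter.
Variables (T : Type) (zero : T) (d : I * I -> T -> T).
Hypothesis d0 : forall pq, d pq zero = zero.
Hypothesis dd : forall pq v, adjacent pq -> d pq (d pq v) = zero.
Hypothesis dC : forall pq rs v, adjacent pq -> adjacent rs ->
  [&& pq.1 != rs.1, pq.1 != rs.2, pq.2 != rs.1 & pq.2 != rs.2] ->
  d pq (d rs v) = d rs (d pq v).
Hypothesis braid : forall a b c v, adjacent (a, b) -> adjacent (b, c) ->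
  d (a, b) (d (b, c) (d (a, b) v)) = d (b, c) (d (a, b) (d (b, c) v)).

Definition nil_op (s : {perm I}) (v : T) := foldr d v (canonical_word s).

(** Matsumoto's theorem in nil-Coxeter form: any descent may be peeled off, not only the one
    selected by [canonical_word]. Two distinct descents are disjoint or share one point; peeling
    further until the remaining permutations agree, the two results are matched by commutation or by
    the braid relation. *)
Lemma nil_op_descent s pq v : s \in G -> adjacent pq -> descent s pq ->
  nil_op s v = d pq (nil_op (s * tperm pq.1 pq.2)%g v).
Proof.
move=> sG; move: s sG pq v.
apply: inversions_ind => s sG IH pq v apq dpq.
have ne1 : s != 1%g.
  by apply/eqP => e; have := inversions_descent sG apq dpq;
     rewrite e inversions1.
have [rs [ars drs e]] := canonical_wordS sG ne1.
have e0 : nil_op s v = d rs (nil_op (s * tperm rs.1 rs.2)%g v).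
  by rewrite /nil_op e.
have [<- //|ne] := eqVneq rs pq.
pose sub (u : {perm I}) (xy : I * I) := (u * tperm xy.1 xy.2)%g.
have subG u xy : u \in G -> adjacent xy -> sub u xy \in G.
  by move=> uG xyA; rewrite block_permM // adjacent_perm.
have sublt u xy : u \in G -> adjacent xy -> descent u xy ->
    #|inversions (sub u xy)| < #|inversions u|.
  by move=> uG xyA xyd; rewrite [X in _ < X](inversions_descent uG xyA xyd).
have desc_sub u x y xy : descent (sub u xy) (x, y) =
    (rk ((u^-1)%g (tperm xy.1 xy.2 y)) < rk ((u^-1)%g (tperm xy.1 xy.2 x))).
  by rewrite /descent /= invMg !permM tpermV.
(* Overlapping descents: the preimages of a, b, c under [s] are in reversed order, so three letters
   can be peeled off on each side, and the braid relation compares them. *)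
have key a b c : adjacent (a, b) -> adjacent (b, c) ->
    descent s (a, b) -> descent s (b, c) ->
    d (a, b) (nil_op (sub s (a, b)) v) = d (b, c) (nil_op (sub s (b, c)) v).
  move=> ab bc dab dbc.
  have [[_ /= /eqP rab] [_ /= /eqP rbc]] := (andP ab, andP bc).
  have nab : a != b by apply: (@rk_add_neq _ _ 0); rewrite addn1.
  have nbc : b != c by apply: (@rk_add_neq _ _ 0); rewrite addn1.
  have nac : a != c by apply: (@rk_add_neq _ _ 1); rewrite addn2 rbc rab.
  have [nba ncb nca] : [/\ b != a, c != b & c != a] by split; rewrite eq_sym.
  have h1 : descent (sub s (a, b)) (b, c).
    rewrite desc_sub /= tpermR (tpermD nac nbc); exact: ltn_trans dbc dab.
  have h2 : descent (sub (sub s (a, b)) (b, c)) (a, b).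
    rewrite desc_sub /= tpermL (tpermD nba nca).
    by rewrite invMg !permM tpermV tpermL (tpermD nac nbc).
  have h3 : descent (sub s (b, c)) (a, b).
    rewrite desc_sub /= tpermL (tpermD nba nca); exact: ltn_trans dbc dab.
  have h4 : descent (sub (sub s (b, c)) (a, b)) (b, c).
    rewrite desc_sub /= tpermR (tpermD nac nbc).
    by rewrite invMg !permM tpermV tpermR (tpermD nba nca).
  have b1 := sublt _ _ sG ab dab.
  have b2 := sublt _ _ (subG _ _ sG ab) bc h1.
  have b3 := sublt _ _ sG bc dbc.
  have b4 := sublt _ _ (subG _ _ sG bc) ab h3.
  rewrite (IH _ (subG _ _ sG ab) b1 (b, c)) //.
  rewrite (IH _ (subG _ _ (subG _ _ sG ab) bc) (ltn_trans b2 b1) (a, b)) //.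
  rewrite (IH _ (subG _ _ sG bc) b3 (a, b)) //.
  rewrite (IH _ (subG _ _ (subG _ _ sG bc) ab) (ltn_trans b4 b3) (b, c)) //.
  rewrite /= -/(sub _ _) braid //; do 3!congr (d _ _); congr (nil_op _ v).
  rewrite /sub /= -!mulgA; congr (_ * _)%g; exact: tperm_braid.
case: pq rs apq dpq ars drs ne e0 {e} => [a b] [a' b'] apq dpq ars drs ne e0.
have [[/= bab /eqP rab] [/= bab' /eqP rab']] := (andP apq, andP ars).
rewrite e0; have [e1|n1] := eqVneq b a'.
  by subst a'; symmetry; exact: key.
have [e2|n2] := eqVneq b' a.
  by subst a; exact: key.
have n3 : a != a'.
  apply: contraNneq ne => e3; subst a'; apply/eqP; congr (_, _).
  apply: rk_inj; last by rewrite rab rab'.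
  by rewrite (blk_trans _ bab) // blk_sym.
have n4 : b != b'.
  apply: contraNneq ne => e3; subst b'; apply/eqP; congr (_, _).
  apply: rk_inj; first by rewrite (blk_trans bab') // blk_sym.
  by apply: succn_inj; rewrite -rab -rab'.
have n2' : a != b' by rewrite eq_sym.
have n1' : a' != b by rewrite eq_sym.
have n3' : a' != a by rewrite eq_sym.
have n4' : b' != b by rewrite eq_sym.
rewrite /= -!/(sub s (_, _)).
rewrite (IH _ (subG _ _ sG ars) (sublt _ _ sG ars drs) (a, b)) //; last first.
  by rewrite desc_sub /= !tpermD.
rewrite (IH _ (subG _ _ sG apq) (sublt _ _ sG apq dpq) (a', b')) //; last first.
  by rewrite desc_sub /= !tpermD.
rewrite dC //=; last by apply/and4P; split.
congr (d _ (d _ (nil_op _ v))); rewrite /sub /= -!mulgA; congr (_ * _)%g.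
exact: tperm_commute.
Qed.

(** If a letter is a descent of the permutation of its tail, it can be peeled off that tail too; it
    then acts twice in a row and gives zero. Only reduced words survive. *)
Lemma foldr_nil_op w v : all adjacent w ->
  foldr d v w =
    if size w == #|inversions (wperm w)| then nil_op (wperm w) v else zero.
Proof.
elim: w => [|pq w IH] /=; first by rewrite inversions1 /nil_op canonical_word1.
case/andP => a aw; have wG := wperm_block aw; rewrite IH //.
have [dsc|nd] := boolP (descent (wperm w) pq).
  have le := size_word_ge aw; have e := inversions_descent wG a dsc.
  rewrite [(size w).+1 == _](_ : _ = false); last first.
    by apply: gtn_eqF; rewrite ltnS (leq_trans _ le) // [leqRHS]e leqnSn.
  by case: ifP; rewrite ?d0 // (nil_op_descent v wG a dsc) dd.
rewrite inversions_ascent // eqSS; case: ifP => // _.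
have wtG : (wperm w * tperm pq.1 pq.2)%g \in G.
  by rewrite block_permM // adjacent_perm.
rewrite (nil_op_descent v wtG a); last by rewrite descent_mul.
by rewrite -mulgA tperm2 mulg1.
Qed.

Lemma nil_opM s t v : s \in G -> t \in G ->
  nil_op s (nil_op t v) =
    if #|inversions s| + #|inversions t| == #|inversions (t * s)|
    then nil_op (t * s)%g v else zero.
Proof.
move=> sG tG; have [as_ ws ss] := canonical_wordP sG.
have [at_ wt st] := canonical_wordP tG.
rewrite {1 2}/nil_op -foldr_cat foldr_nil_op ?all_cat ?as_ //.
by rewrite size_cat ss st wperm_cat ws wt.
Qed.

End NilCoxeter.

(** * The longest element *)

Lemma exists_longest : exists2 w, w \in G &
  forall p q, blk p q -> rk p < rk q -> rk (w q) < rk (w p).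
Proof.
case: (@arg_maxnP _ 1%g (mem G) (fun s => #|inversions s|) block_perm1) => w wG max.
exists w => //.
(* An ascent would produce a permutation with more inversions than the maximum. *)
have dec p q : adjacent (p, q) -> rk ((w^-1)%g q) < rk ((w^-1)%g p).
  move=> h; apply: contraT => nd.
  have hG : (w * tperm p q)%g \in G.
    by rewrite block_permM // block_tperm //; case/andP: h.
  by have := max _ hG; rewrite /= (inversions_ascent wG h nd) ltnn.
have dec2 p q : blk p q -> rk p < rk q -> rk ((w^-1)%g q) < rk ((w^-1)%g p).
  apply: (block_ind (P := fun p q => rk ((w^-1)%g q) < rk ((w^-1)%g p))) => //.
  by move=> a b c h1 h2; apply: ltn_trans h2 h1.
move=> p q pq lt; have bw : blk (w p) (w q) by rewrite blk_perm.
case: (ltngtP (rk (w p)) (rk (w q))) => // [lt2|e].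
  by have := dec2 _ _ bw lt2; rewrite !permK; lia.
by have/perm_inj e2 := rk_inj bw e; rewrite e2 ltnn in lt.
Qed.

Section Longest.
Variable w0 : {perm I}.
Hypothesis w0G : w0 \in G.
Hypothesis w0_dec : forall p q, blk p q -> rk p < rk q -> rk (w0 q) < rk (w0 p).

Lemma inversions_le s : #|inversions s| <= #|block_pairs|.
Proof. by apply/subset_leq_card/subsetP => pq; rewrite inE => /andP[]. Qed.

Lemma inversions_longest : #|inversions w0| = #|block_pairs|.
Proof.
apply: eq_card => pq; rewrite inE andb_idr //.
by rewrite inE => /andP[]; apply: w0_dec.
Qed.

Lemma longestP s : s \in G -> #|inversions s| = #|block_pairs| -> s = w0.
Proof.
move=> sG e.
have : inversions s == block_pairs.
  by rewrite eqEcard e leqnn andbT; apply/subsetP => pq; rewrite inE => /andP[].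
move/eqP => e2; have sdec p q : blk p q -> rk p < rk q -> rk (s q) < rk (s p).
  move=> pq lt; have : (p, q) \in inversions s by rewrite e2 inE /= pq.
  by rewrite inE => /andP[].
suff h : (s^-1 * w0 = 1)%g by rewrite -(mulKVg s w0) h mulg1.
apply: increasing_block_perm; first by rewrite block_permM // block_permV.
move=> p q /andP[/= pq /eqP r]; rewrite !permM; apply: w0_dec.
  by rewrite blk_perm ?block_permV // blk_sym.
have bs : blk ((s^-1)%g p) ((s^-1)%g q) by rewrite blk_perm ?block_permV.
case: (ltngtP (rk ((s^-1)%g q)) (rk ((s^-1)%g p))) => // [lt|e3].
  by have := sdec _ _ bs lt; rewrite !permKV r ltnNge leqnSn.
by have/perm_inj e4 := rk_inj bs (esym e3); rewrite e4 in r; lia.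
Qed.

(** The map [swap] carries the inversions of [w0 * s^-1] bijectively onto the ordered pairs that [s]
    does not invert. *)
Lemma inversions_longestV s : s \in G ->
  #|inversions (w0 * s^-1)| + #|inversions s| = #|block_pairs|.
Proof.
move=> sG; pose swap (pq : I * I) := ((s^-1)%g (w0 pq.2), (s^-1)%g (w0 pq.1)).
have swap_inj : injective swap.
  by move=> [a b] [c d] [/perm_inj/perm_inj -> /perm_inj/perm_inj ->].
have w0lt p q : blk p q -> (rk (w0 q) < rk (w0 p)) = (rk p < rk q).
  move=> pq; case: (ltngtP (rk p) (rk q)) => [|lt|/(rk_inj pq) ->].
  - exact: w0_dec.
  - by apply/negbTE; rewrite -leqNgt ltnW // w0_dec // blk_sym.
  - by rewrite ltnn.
rewrite -(card_imset _ swap_inj) addnC -(cardsID (inversions s) block_pairs).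
congr (_ + _); apply: eq_card => -[u v].
  by rewrite !inE /=; case: (blk u v && (rk u < rk v)).
apply/imsetP/idP => [[[p q]]|]; rewrite !inE /=.
  rewrite !permM => /andP[/andP[pq lt] lt2] [-> ->]; rewrite !permKV lt2.
  rewrite blk_perm ?block_permV // blk_perm // blk_sym pq /=.
  by rewrite -leqNgt ltnW // w0_dec.
move=> /andP[ninv /andP[uv lt]]; rewrite uv lt /= -leqNgt in ninv.
exists ((w0^-1)%g (s v), (w0^-1)%g (s u)); last by rewrite /swap /= !permKV !permK.
rewrite !inE /= !permM !permKV !permK lt andbT.
have b : blk ((w0^-1)%g (s v)) ((w0^-1)%g (s u)).
  by rewrite blk_perm ?block_permV // blk_perm // blk_sym.
rewrite b /= -w0lt // !permKV ltn_neqAle ninv andbT rk_neq ?blk_perm //.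
by rewrite (inj_eq perm_inj); apply/eqP => e; rewrite e ltnn in lt.
Qed.

End Longest.

(** * Divided differences *)

Section NilHecke.
Local Open Scope ring_scope.
Variables (K : fieldType) (x : I -> K) (pm : {perm I} -> {rmorphism K -> K}).
Hypothesis pm1 : forall f, pm 1%g f = f.
Hypothesis pmM : forall s t f, pm (s * t)%g f = pm t (pm s f).
Hypothesis pmx : forall s p, pm s (x p) = x (s p).
Hypothesis x_inj : injective x.
Hypothesis K_char0 : forall m, m.+1%:R != 0 :> K.

Definition Delta : K := \prod_(pq in block_pairs) (x pq.1 - x pq.2).

Lemma x_neq p q : p != q -> x p - x q != 0.
Proof. by rewrite subr_eq0 (inj_eq x_inj). Qed.

Lemma adjacent_neq pq : adjacent pq -> pq.1 != pq.2.
Proof.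
by case/andP => _ /eqP e; apply: (@rk_add_neq _ _ 0); rewrite addn1.
Qed.

Lemma Delta_neq0 : Delta != 0.
Proof.
apply/prodf_neq0 => -[p q]; rewrite inE /= => /andP[_ lt].
by apply: x_neq; apply: contraTneq lt => ->; rewrite ltnn.
Qed.

(** The transposition negates the factor of its own pair and permutes the others, each remaining
    correctly ordered by [rk_tperm]. *)
Lemma Delta_adjacent pq : adjacent pq -> pm (tperm pq.1 pq.2) Delta = - Delta.
Proof.
case: pq => a b ab /=; have [/= hab /eqP rab] := andP ab.
have ba : b != a by rewrite eq_sym; have := adjacent_neq ab.
have inab : (a, b) \in block_pairs by rewrite inE /= hab rab ltnSn.
rewrite /Delta rmorph_prod (bigD1 (a, b)) //= [in RHS](bigD1 (a, b)) //=.
rewrite rmorphB /= !pmx tpermL tpermR -mulNr opprB; congr (_ * _).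
pose h (uv : I * I) := (tperm a b uv.1, tperm a b uv.2).
have hh : involutive h by case=> u v; rewrite /h /= !tpermK.
rewrite [RHS](reindex_inj (inv_inj hh)) /=.
have sub uv : (uv \in block_pairs) && (uv != (a, b)) ->
    (h uv \in block_pairs) && (h uv != (a, b)).
  case: uv => u v /andP[]; rewrite !inE /= => /andP[uv lt] ne.
  rewrite blk_perm ?block_tperm // uv rk_tperm //=.
  apply: contraTneq lt => -[e1 e2]; rewrite -leqNgt.
  have -> : u = b by rewrite -(tpermK a b u) e1 tpermL.
  have -> : v = a by rewrite -(tpermK a b v) e2 tpermR.
  by rewrite rab.
apply: eq_big => [uv|uv _]; last by rewrite rmorphB /= !pmx.
by apply/idP/idP => [/sub//|/sub]; rewrite hh.
Qed.

Lemma Delta_sign s : s \in G -> pm s Delta = (-1) ^+ s * Delta.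
Proof.
move=> /canonical_wordP[aw <- _]; move: aw; elim: (canonical_word s) => [|pq w IH] /=.
  by rewrite pm1 odd_perm1 mul1r.
case/andP => a /IH e; rewrite pmM e rmorphM rmorph_sign Delta_adjacent //.
rewrite odd_permM odd_tperm adjacent_neq // addbT.
by case: (odd_perm _); rewrite !(expr0, expr1) ?mulN1r ?mul1r ?opprK.
Qed.

(** * Alternating sums under a semilinear action *)

Section Semilinear.
Variables (V : lmodType K) (pv : {perm I} -> V -> V).
Hypothesis pvM : forall s t v, s \in G -> t \in G ->
  pv (s * t)%g v = pv t (pv s v).
Hypothesis pvD : forall s, {morph pv s : u v / u + v}.
Hypothesis pvZ : forall s f v, pv s (f *: v) = pm s f *: pv s v.

Definition ddiff (pq : I * I) (v : V) : V :=
  (x pq.1 - x pq.2)^-1 *: (v - pv (tperm pq.1 pq.2) v).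

Definition alt (v : V) : V := \sum_(s in G) pv s (Delta^-1 *: v).

Lemma pv0 s : pv s 0 = 0.
Proof. by rewrite -[X in pv s X](scale0r 0) pvZ rmorph0 scale0r. Qed.

Lemma altD u v : alt (u + v) = alt u + alt v.
Proof. by rewrite -big_split; apply: eq_bigr => s _; rewrite scalerDr pvD. Qed.

Lemma alt0 : alt 0 = 0.
Proof. by rewrite /alt big1 // => s _; rewrite scaler0 pv0. Qed.

Lemma altN v : alt (- v) = - alt v.
Proof. by apply/eqP; rewrite -addr_eq0 -altD addNr alt0. Qed.

Lemma alt_sum (J : Type) (r : seq J) (P : pred J) F :
  alt (\sum_(i <- r | P i) F i) = \sum_(i <- r | P i) alt (F i).
Proof. exact: (big_morph _ altD alt0). Qed.

Lemma alt_perm s v : s \in G -> alt (pv s v) = (-1) ^+ s *: alt v.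
Proof.
move=> sG; rewrite /alt scaler_sumr.
rewrite (reindex_inj (mulgI (s^-1)%g)) /=.
have GE t : (s^-1 * t \in G)%g = (t \in G).
  apply/idP/idP => h; last by rewrite block_permM ?block_permV.
  by rewrite -(mulKVg s t) block_permM.
apply: eq_big => // t tG; rewrite !pvZ -pvM // mulKVg.
have e : pm (s^-1)%g (Delta^-1) = (-1) ^+ s * Delta^-1.
  by rewrite fmorphV Delta_sign ?block_permV // odd_permV invfM invr_sign.
by rewrite scalerA pmM e rmorphM rmorph_sign.
Qed.

Definition invariant (f : K) := forall s, s \in G -> pm s f = f.

Lemma altZ c v : invariant c -> alt (c *: v) = c *: alt v.
Proof.
move=> ic; rewrite /alt scaler_sumr; apply: eq_bigr => s sG.
by rewrite scalerA mulrC -scalerA pvZ ic.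
Qed.

(** Self-adjointness: the transposition negates both [alt] and the difference of the two variables.
    The signs cancel, so the two terms of the divided difference of v recombine into that of f. *)
Lemma alt_ddiff f pq v : adjacent pq ->
  alt (f *: ddiff pq v) =
  alt (((x pq.1 - x pq.2)^-1 * (f - pm (tperm pq.1 pq.2) f)) *: v).
Proof.
move=> a; have n0 := x_neq (adjacent_neq a).
set d := x pq.1 - x pq.2 in n0 *; set t := tperm _ _.
have td : pm t d = - d by rewrite rmorphB /= !pmx tpermL tpermR opprB.
have tG : t \in G by apply: adjacent_perm.
rewrite /ddiff -/d -/t scalerA scalerBr altD altN.
have -> : (f / d) *: pv t v = pv t ((- pm t f / d) *: v).
  rewrite pvZ; congr (_ *: _); rewrite rmorphM rmorphN fmorphV td -pmM tperm2 pm1.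
  by rewrite invrN mulrNN.
rewrite alt_perm // odd_tperm adjacent_neq // scaleN1r opprK -altD -scalerDl.
by rewrite mulrBr mulNr mulrC [_ * pm t f]mulrC.
Qed.

End Semilinear.

Local Notation pmo := (fun s => pm s : K^o -> K^o).
Local Notation dK := (ddiff (V := K^o) pmo).
Local Notation altK := (alt (V := K^o) pmo).

Lemma dKE pq f : dK pq f = (x pq.1 - x pq.2)^-1 * (f - pm (tperm pq.1 pq.2) f).
Proof. by []. Qed.

Lemma dK0 pq : dK pq 0 = 0.
Proof. by rewrite dKE rmorph0 subr0 mulr0. Qed.

Lemma dKD pq f g : dK pq (f + g) = dK pq f + dK pq g.
Proof. by rewrite !dKE -mulrDr rmorphD opprD addrACA. Qed.

Lemma perm_dK s pq f : pm s (dK pq f) =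
  (x (s pq.1) - x (s pq.2))^-1 * (pm s f - pm (tperm pq.1 pq.2 * s) f).
Proof. by rewrite dKE rmorphM fmorphV !rmorphB /= !pmx pmM. Qed.

Lemma pm_dK pq f : adjacent pq -> pm (tperm pq.1 pq.2) (dK pq f) = dK pq f.
Proof.
move=> a; rewrite !dKE rmorphM fmorphV !rmorphB /= !pmx tpermL tpermR.
by rewrite -pmM tperm2 pm1 -opprB invrN mulNr -mulrN opprB.
Qed.

Lemma dK_dK pq f : adjacent pq -> dK pq (dK pq f) = 0.
Proof. by move=> a; rewrite dKE pm_dK // subrr mulr0. Qed.

Lemma dK_commute pq rs f : adjacent pq -> adjacent rs ->
  [&& pq.1 != rs.1, pq.1 != rs.2, pq.2 != rs.1 & pq.2 != rs.2] ->
  dK pq (dK rs f) = dK rs (dK pq f).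
Proof.
case: pq rs => [a b] [c d] /= h1 h2 /and4P[ac ad bc bd].
have n1 := x_neq (adjacent_neq h1); have n2 := x_neq (adjacent_neq h2).
rewrite dKE perm_dK [RHS]dKE perm_dK /= !dKE /= (tperm_commute ac ad bc bd).
rewrite (tpermD ac bc) (tpermD ad bd).
have [ca da cb db] : [/\ c != a, d != a, c != b & d != b] by split; rewrite eq_sym.
rewrite (tpermD ca da) (tpermD cb db); move: n1 n2 => /=.
set A := x a; set B := x b; set C := x c; set D := x d.
by move=> n1 n2; field; rewrite n1 n2.
Qed.

(** Both sides expand over the permutations of a, b, c. After the two expressions of the
    order-reversing permutation are identified by [tperm_braid], what is left is an identity of
    rational functions. *)
Lemma dK_braid a b c f : adjacent (a, b) -> adjacent (b, c) ->
  dK (a, b) (dK (b, c) (dK (a, b) f)) = dK (b, c) (dK (a, b) (dK (b, c) f)).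
Proof.
move=> h1 h2; have [/= _ /eqP r1] := andP h1; have [/= _ /eqP r2] := andP h2.
have n1 := adjacent_neq h1; have n2 := adjacent_neq h2; rewrite /= in n1 n2.
have nac : a != c by apply: (@rk_add_neq _ _ 1); rewrite addn2 r2 r1.
have [nba ncb nca] : [/\ b != a, c != b & c != a] by split; rewrite eq_sym.
have := x_neq n1; have := x_neq n2; have := x_neq nac.
rewrite !(dKE, perm_dK) /=.
do 2! rewrite ?rmorphM ?fmorphV ?rmorphB /= ?pmx.
have := tperm_braid n1 n2 nac; rewrite !mulgA -!pmM => ->.
rewrite !(tpermL, tpermR, (tpermD nac n2), (tpermD nba nca)) !tperm2 !pm1.
set A := x a; set B := x b; set C := x c => d1 d2 d3.
have [d1' d2' d3'] : [/\ C - A != 0, C - B != 0 & B - A != 0].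
  by rewrite -(opprB A) -(opprB B) -(opprB A) !oppr_eq0.
field.
by rewrite d1 d2 d2' d3 d3'.
Qed.

Local Notation Dn := (nil_op (T := K) dK).

Lemma foldr_dKD w f g : foldr dK (f + g) w = foldr dK f w + foldr dK g w.
Proof. by elim: w => //= pq w ->; rewrite dKD. Qed.

Lemma foldr_dKZ w c f : all adjacent w -> invariant c ->
  foldr dK (c * f) w = c * foldr dK f w.
Proof.
move=> + ic; elim: w => //= pq w IH /andP[a /IH ->].
by rewrite !dKE rmorphM ic ?adjacent_perm // -mulrBr mulrCA.
Qed.

Lemma invariantP f : (forall pq, adjacent pq -> pm (tperm pq.1 pq.2) f = f) ->
  invariant f.
Proof.
move=> H s /canonical_wordP[aw <- _]; move: aw.
elim: (canonical_word s) => [|pq w IH] /=; first by rewrite pm1.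
by case/andP => a /IH e; rewrite pmM e H.
Qed.

Lemma invariantV c : invariant c -> invariant c^-1.
Proof. by move=> ic s sG; rewrite fmorphV ic. Qed.

Lemma invariantM c d : invariant c -> invariant d -> invariant (c * d).
Proof. by move=> ic id s sG; rewrite rmorphM ic ?id. Qed.

Lemma invariant_nat m : invariant m%:R.
Proof. by move=> s _; rewrite rmorph_nat. Qed.

Lemma Dn0 s : Dn s 0 = 0.
Proof. by rewrite /nil_op; elim: canonical_word => //= pq w ->; rewrite dK0. Qed.

Lemma DnD s f g : Dn s (f + g) = Dn s f + Dn s g.
Proof. exact: foldr_dKD. Qed.

Lemma DnN s f : Dn s (- f) = - Dn s f.
Proof. by apply/eqP; rewrite -addr_eq0 -DnD addNr Dn0. Qed.

Lemma Dn_sum s (J : Type) (r : seq J) (P : pred J) F :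
  Dn s (\sum_(i <- r | P i) F i) = \sum_(i <- r | P i) Dn s (F i).
Proof. exact: (big_morph _ (DnD s) (Dn0 s)). Qed.

Lemma DnZ s c f : s \in G -> invariant c -> Dn s (c * f) = c * Dn s f.
Proof. by move=> /canonical_wordP[aw _ _] ic; apply: foldr_dKZ. Qed.

Lemma DnM s t f : s \in G -> t \in G ->
  Dn s (Dn t f) =
    if (#|inversions s| + #|inversions t| == #|inversions (t * s)|)%N
    then Dn (t * s)%g f else 0.
Proof.
by move=> sG tG; apply: nil_opM => //;
   [exact: dK0 | exact: dK_dK | exact: dK_commute | exact: dK_braid].
Qed.

Lemma Dn_longest_invariant w0 f : w0 \in G ->
  (forall p q, blk p q -> (rk p < rk q)%N -> (rk (w0 q) < rk (w0 p))%N) ->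
  invariant (Dn w0 f).
Proof.
move=> wG dec; apply: invariantP => pq a; have n0 := x_neq (adjacent_neq a).
suff : dK pq (Dn w0 f) == 0.
  by rewrite dKE mulf_eq0 invr_eq0 (negPf n0) subr_eq0 => /eqP <-.
have [|nd] := boolP (descent w0 pq); last first.
  have := inversions_le (w0 * tperm pq.1 pq.2).
  by rewrite (inversions_ascent wG a nd) -(inversions_longest dec) ltnn.
move=> d; apply/eqP.
rewrite (nil_op_descent dK_commute dK_braid f wG a d).
exact: dK_dK.
Qed.

(** Artin's independence of automorphisms. To isolate t from s, take p with t p different from s p:
    the relation at x p * f minus x (s p) times the relation at f has no term at s. *)
Lemma perm_independent (S : {set {perm I}}) (a : {perm I} -> K) :
  (forall f, \sum_(s in S) a s * pm s f = 0) -> forall s, s \in S -> a s = 0.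
Proof.
move: {2}#|S| (leqnn #|S|) => m; elim: m S a => [|m IH] S a.
  by rewrite leqn0 cards_eq0 => /eqP-> _ s; rewrite inE.
move=> le H s sS.
have Ht t : t \in S :\ s -> a t = 0.
  move=> tS; have [ne tS'] := setD1P tS.
  have [p np] : exists p, t p != s p.
    apply/existsP; apply: contraNT ne => /existsPn H2.
    by apply/eqP/permP => p; apply/eqP; have := H2 p; rewrite negbK.
  have e : a t * (x (t p) - x (s p)) = 0.
    apply: (IH (S :\ s) (fun u => a u * (x (u p) - x (s p)))) => //.
      by move: le; rewrite (cardsD1 s) sS.
    move=> f; have := H (x p * f); have := H f.
    rewrite (bigD1 s) //= => e1; rewrite (bigD1 s) //= => e2.
    transitivity (\sum_(i in S | i != s) (a i * pm i (x p * f) - x (s p) * (a i * pm i f))).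
      apply: eq_big => [u|u _]; first by rewrite in_setD1 andbC.
      by rewrite rmorphM /= pmx; ring.
    rewrite sumrB -mulr_sumr.
    have -> : \sum_(i in S | i != s) a i * pm i f = - (a s * pm s f).
      by apply/eqP; rewrite -addr_eq0 addrC e1.
    have -> : \sum_(i in S | i != s) a i * pm i (x p * f) = - (a s * pm s (x p * f)).
      by apply/eqP; rewrite -addr_eq0 addrC e2.
    by rewrite rmorphM /= pmx; ring.
  move/eqP: e; rewrite mulf_eq0 (negPf (x_neq np)) orbF => /eqP //.
have := H 1; rewrite (bigD1 s) //= big1 => [|t /andP[tS ne]].
  by rewrite addr0 rmorph1 mulr1.
by rewrite Ht ?mul0r // in_setD1 ne.
Qed.

(* Triangularity of divided differences: the coefficient of s itself is the
   inverse of the product of the root differences inverted by s. *)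
Lemma Dn_expansion s : s \in G -> exists a : {perm I} -> K,
  [/\ forall f, Dn s f = \sum_(t in G) a t * pm t f,
      forall t, t \in G -> t != s -> (#|inversions s| <= #|inversions t|)%N -> a t = 0
    & a s * \prod_(pq in inversions s) (x (s pq.1) - x (s pq.2)) = 1].
Proof.
move: s; apply: inversions_ind => s sG IH.
have [->|ne] := eqVneq s 1%g.
  exists (fun t => (t == 1%g)%:R); split.
  - move=> f; rewrite /nil_op canonical_word1 (bigD1 1%g) ?block_perm1 //= eqxx.
    rewrite mul1r pm1 big1 ?addr0 // => t /andP[_ /negPf ->]; exact: mul0r.
  - by move=> t _ /negPf -> _.
  - rewrite eqxx mul1r big1 // => pq; have := inversions1.
    by move/eqP; rewrite cards_eq0 => /eqP ->; rewrite inE.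
have [[u v] [a d _]] := canonical_wordS sG ne.
have n0 := x_neq (adjacent_neq a); rewrite /= in n0.
set t := tperm u v; pose r := (s * t)%g.
have tG : t \in G by apply: (adjacent_perm a).
have rG : r \in G by rewrite block_permM.
have es : s = (r * t)%g by rewrite /r -mulgA tperm2 mulg1.
have inv_s : #|inversions s| = #|inversions r|.+1 := inversions_descent sG a d.
have [//||b [bE b0 b1]] := IH r; first by rewrite inv_s.
exists (fun w => (x u - x v)^-1 * (b w - pm t (b (w * t)%g))); split.
- move=> f; rewrite (nil_op_descent dK_commute dK_braid f sG a d).
  rewrite -/r bE dKE /= -/t; under [RHS]eq_bigr do rewrite -mulrA mulrBl.
  rewrite -mulr_sumr; congr (_ * _); rewrite sumrB; congr (_ - _).
  rewrite rmorph_sum [RHS](reindex_inj (mulIg t)) /=.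
  apply: eq_big => [w|w _]; last by rewrite rmorphM -mulgA tperm2 mulg1 pmM.
  apply/idP/idP => h; first by rewrite block_permM.
  by rewrite -(mulgK t w) tpermV block_permM.
- move=> w wG nw le.
  have h1 : b w = 0.
    apply: b0 => //; last by rewrite (leq_trans _ le) // inv_s.
    by apply: contraTneq le => ->; rewrite inv_s ltnn.
  have h2 : b (w * t)%g = 0.
    have wtG : (w * t)%g \in G by rewrite block_permM.
    apply: b0 => //.
      by apply: contraNneq nw => e; rewrite es -e -mulgA tperm2 mulg1.
    have [dw|ndw] := boolP (descent w (u, v)).
      by have := inversions_descent wG a dw; rewrite -/t => e; rewrite e inv_s in le.
    have := inversions_ascent wG a ndw; rewrite -/t => ->.
    by rewrite (leq_trans _ (leqnSn _)) // (leq_trans _ le) // inv_s.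
  by rewrite h1 h2 rmorph0 subr0 mulr0.
- have h1 : b s = 0.
    apply: b0 => //; last by rewrite inv_s.
    by apply/eqP => e; move: inv_s; rewrite -e => /n_Sn.
  rewrite h1 sub0r -/r.
  pose pr := ((r^-1)%g u, (r^-1)%g v).
  have ndr : ~~ descent r (u, v) by rewrite (descent_mul sG a) d.
  (* [s] has one inversion more than [r]. Its factor x v - x u cancels the denominator of the added
     divided difference together with the minus sign in front of [pm t]. *)
  have [ei notin] := inversions_ascentE rG a ndr.
  rewrite -es in ei; rewrite ei big_setU1 //= mulrCA mulrA.
  have -> : x (s ((r^-1)%g u)) - x (s ((r^-1)%g v)) = x v - x u.
    by rewrite es permM permKV permM permKV tpermL tpermR.
  have := congr1 (pm t) b1; rewrite rmorphM rmorph_prod rmorph1 => e1.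
  rewrite -[RHS]e1 (eq_bigr (fun pq => pm t (x (r pq.1) - x (r pq.2)))); last first.
    by move=> pq _; rewrite rmorphB /= !pmx es !permM.
  set PR := \prod_(_ in _) _; set b' := pm t (b r).
  by field.
Qed.

(** * Divided differences of the Vandermonde product *)

Section DeltaBasis.
Variable w0 : {perm I}.
Hypothesis w0G : w0 \in G.
Hypothesis w0_dec :
  forall p q, blk p q -> (rk p < rk q)%N -> (rk (w0 q) < rk (w0 p))%N.

Lemma longest_involutive : (w0^-1 = w0)%g.
Proof.
suff h : (w0 * w0 = 1)%g by rewrite -[LHS]mulg1 -h mulKg.
apply: increasing_block_perm; first by rewrite block_permM.
move=> p q /andP[/= pq /eqP r]; rewrite !permM; apply: w0_dec.
  by rewrite blk_perm // blk_sym.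
by apply: w0_dec => //; rewrite r.
Qed.

Lemma altK_adjoint w f g : all adjacent w ->
  altK (f * foldr dK g w) = altK (foldr dK f (rev w) * g).
Proof.
elim: w f => [//|pq w IH] f /= /andP[a aw].
rewrite rev_cons foldr_rcons /= -IH //.
rewrite [LHS](alt_ddiff (V := K^o) (pv := pmo)) //.
- by move=> s u v; exact: rmorphD.
- by move=> s u v; exact: rmorphM.
Qed.

(** Write h for the left-hand side. Self-adjointness and the invariance of [Dn w0 g] give h * A(g) =
    |G| * D_{w0}(g) for all g. By independence of automorphisms the coefficients of [w0] agree, and
    both are known up to h: the sign of [w0] over [Delta] on one side, [Dn_expansion] on the
    other. *)
Lemma Dn_longest_Delta : Dn w0 Delta = #|G|%:R.
Proof.
have [aw ww sw] := canonical_wordP w0G.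
have [a [aE _ a1]] := Dn_expansion w0G.
set h := Dn w0 Delta; have ih : invariant h := Dn_longest_invariant _ w0G w0_dec.
have key g : h * altK g = #|G|%:R * Dn w0 g.
  transitivity (altK (h * g)).
    by rewrite [RHS](altZ (V := K^o) (pv := pmo)) // => s u v; rewrite /= rmorphM.
  (* Adjointness moves the word from [Delta] to g and reverses it; the reversed word is again a
     reduced word of [w0], as [w0] is an involution. *)
  have -> : h = foldr dK Delta (rev (rev (canonical_word w0))) by rewrite revK.
  rewrite -altK_adjoint ?all_rev //.
  have -> : foldr dK g (rev (canonical_word w0)) = Dn w0 g.
    rewrite (foldr_nil_op (zero := 0 : K) dK0 dK_dK dK_commute dK_braid) ?all_rev //.
    by rewrite size_rev wperm_rev ww longest_involutive sw eqxx.
  rewrite /alt -sum1_card natr_sum mulr_suml; apply: eq_bigr => s sG.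
  have -> : Delta^-1 *: (Delta * Dn w0 g : K^o) = Dn w0 g.
    exact: mulKf Delta_neq0 _.
  by rewrite /= mul1r (Dn_longest_invariant _ w0G w0_dec).
have H : h * (-1) ^+ w0 / Delta - #|G|%:R * a w0 = 0.
  apply: (@perm_independent G (fun s => h * (-1) ^+ s / Delta - #|G|%:R * a s)) => //.
  move=> f; under eq_bigr do rewrite mulrBl -!mulrA; rewrite sumrB -!mulr_sumr.
  apply/eqP; rewrite subr_eq0 -aE -key; apply/eqP; congr (_ * _).
  apply: eq_bigr => s sG; rewrite rmorphM fmorphV Delta_sign // invfM.
  by rewrite invr_sign mulrA.
have e : \prod_(pq in inversions w0) (x (w0 pq.1) - x (w0 pq.2)) = (-1) ^+ w0 * Delta.
  rewrite -Delta_sign // rmorph_prod; apply: eq_big => [pq|pq _].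
    by rewrite inE andb_idr // inE => /andP[]; apply: w0_dec.
  by rewrite rmorphB /= !pmx.
move: H => /eqP; rewrite subr_eq0 => /eqP H.
transitivity (h * (-1) ^+ w0 / Delta * ((-1) ^+ w0 * Delta)).
  by rewrite mulrA mulrAC mulfVK ?Delta_neq0 // -mulrA -expr2 sqrr_sign mulr1.
by rewrite H -e -mulrA a1 mulr1.
Qed.

Section Span.
Variable Pol : K -> Prop.
Hypothesis PolB : forall f g, Pol f -> Pol g -> Pol (f - g).
Hypothesis PolM : forall f g, Pol f -> Pol g -> Pol (f * g).
Hypothesis Pol_x : forall p, Pol (x p).
Hypothesis Pol_natV : forall m, Pol (m.+1%:R^-1).
Hypothesis Pol_diff : forall p q f, p != q -> Pol f ->
  Pol ((x p - x q)^-1 * (f - pm (tperm p q) f)).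

Lemma Pol0 : Pol 0.
Proof. by rewrite -(subrr (1%:R^-1)); apply: PolB. Qed.

Lemma Pol_foldr w f : all adjacent w -> Pol f -> Pol (foldr dK f w).
Proof.
move=> + Pf; elim: w => //= pq w IH /andP[a /IH]; apply: Pol_diff.
exact: adjacent_neq.
Qed.

Lemma Pol_Dn s f : s \in G -> Pol f -> Pol (Dn s f).
Proof. by move=> /canonical_wordP[aw _ _]; apply: Pol_foldr. Qed.

(* Descending induction on the length l below which divided differences of f
   may be nonzero: those of length exactly l are invariant and are removed by
   the elements dual to them. *)
Lemma Delta_span (P : K -> Prop) :
  P 0 -> (forall f g, P f -> P g -> P (f + g)) ->
  (forall c s, s \in G -> Pol c -> invariant c -> P (c * Dn s Delta)) ->
  forall f, Pol f -> P f.
Proof.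
move=> P0 PD PDelta.
suff main l : forall f, Pol f ->
    (forall s, s \in G -> (l <= #|inversions s|)%N -> Dn s f = 0) -> P f.
  move=> f Pf; apply: (main #|block_pairs|.+1 f Pf) => s sG.
  by rewrite ltnNge inversions_le.
elim: l => [|l IH] f Pf H.
  suff -> : f = 0 by [].
  have := H 1%g block_perm1; rewrite /nil_op canonical_word1 /=; exact.
pose N : K := #|G|%:R.
have N_gt0 : (0 < #|G|)%N by apply/card_gt0P; exists 1%g; apply: block_perm1.
have NV : Pol N^-1 by rewrite /N -(prednK N_gt0); apply: Pol_natV.
have N0 : N != 0 by rewrite /N -(prednK N_gt0) K_char0.
(* One more divided difference of [Dn s f] is either zero by the nil relation or has length l + 1,
   where those of f vanish. *)
have iD s : s \in G -> #|inversions s| = l -> invariant (Dn s f).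
  move=> sG es; apply: invariantP => pq a; have n0 := x_neq (adjacent_neq a).
  suff : dK pq (Dn s f) == 0.
    by rewrite dKE mulf_eq0 invr_eq0 (negPf n0) subr_eq0 => /eqP <-.
  have stG : (s * tperm pq.1 pq.2)%g \in G by rewrite block_permM // adjacent_perm.
  have [d|nd] := boolP (descent s pq).
    by rewrite (nil_op_descent dK_commute dK_braid f sG a d) dK_dK.
  have e : Dn (s * tperm pq.1 pq.2)%g f = dK pq (Dn s f).
    rewrite (nil_op_descent dK_commute dK_braid f stG a) ?descent_mul //.
    by rewrite -mulgA tperm2 mulg1.
  by rewrite -e H // inversions_ascent // es.
have wsG s : s \in G -> (w0 * s^-1)%g \in G.
  by move=> sG; rewrite block_permM ?block_permV.
(* For t of length at least l, applying D_t to D_{w0 s^-1}(Delta) gives zero unless the lengths add;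
   the product then has maximal length, hence is [w0], which forces t = s and yields the constant
   [N]. *)
pose g s := N^-1 * Dn s f * Dn (w0 * s^-1)%g Delta.
pose J := [set s in G | #|inversions s| == l].
have JP s : s \in J -> s \in G /\ #|inversions s| = l.
  by rewrite inE => /andP[-> /eqP].
rewrite -[f](subrK (\sum_(s in J) g s)); apply: (PD); last first.
  apply: (big_ind P) => // s sJ; have [sG es] := JP s sJ; apply: PDelta; first exact: wsG.
    by apply: PolM => //; apply: Pol_Dn.
  by apply: invariantM; [apply: invariantV; apply: invariant_nat | apply: iD].
apply: IH.
  apply: PolB => //; apply: (big_ind Pol) => [|u v Pu Pv|s sJ].
  - exact: Pol0.
  - by rewrite -[v]opprK -[- v]sub0r; apply: PolB => //; apply: PolB => //; apply: Pol0.
  - have [sG _] := JP s sJ; apply: PolM; first by apply: PolM => //; apply: Pol_Dn.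
    apply: Pol_Dn; first exact: wsG.
    apply: (big_ind Pol) => [|//|pq _]; last exact: PolB.
    by rewrite -[1]invr1 (_ : 1 = 1%:R) //; apply: Pol_natV.
move=> t tG le; rewrite DnD DnN Dn_sum.
have gE s : s \in J -> Dn t (g s) = if s == t then Dn t f else 0.
  move=> sJ; have [sG es] := JP s sJ.
  have ic : invariant (N^-1 * Dn s f).
    by apply: invariantM; [apply: invariantV; apply: invariant_nat | apply: iD].
  rewrite /g DnZ // DnM //; last exact: wsG.
  have eN := inversions_longestV w0G w0_dec sG; rewrite es in eN.
  have [e|ne] := eqVneq s t.
    subst t; rewrite mulgKV (inversions_longest w0_dec) -eN addnC es eqxx.
    by rewrite Dn_longest_Delta -/N mulrAC mulVf ?mul1r.
  case: eqP; rewrite ?mulr0 // => e2.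
  have e3 : #|inversions (w0 * s^-1 * t)| = #|block_pairs|.
    apply/eqP; rewrite eqn_leq inversions_le -e2 -eN addnC leq_add2r.
    exact: le.
  have := longestP w0G w0_dec (block_permM (wsG _ sG) tG) e3 => e4.
  by case/eqP: ne; apply: (mulgI (w0 * s^-1)%g); rewrite e4 mulgKV.
have [e|ne] := eqVneq #|inversions t| l.
  have tJ : t \in J by rewrite inE tG e eqxx.
  rewrite (bigD1 t) //= gE // eqxx big1 ?addr0 ?subrr // => s /andP[sJ /negPf ns].
  by rewrite gE // ns.
rewrite H //; last by rewrite ltn_neqAle eq_sym ne.
rewrite big1 ?subr0 // => s sJ; rewrite gE //; case: eqP => // es.
by have [_ e2] := JP s sJ; rewrite es in e2; rewrite e2 eqxx in ne.
Qed.

End Span.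
End DeltaBasis.

(** * Lattices spanned by alternating sums, in abstract form *)

Section LatticeCore.
Variable Pol : K -> Prop.
Hypothesis PolB : forall f g, Pol f -> Pol g -> Pol (f - g).
Hypothesis PolM : forall f g, Pol f -> Pol g -> Pol (f * g).
Hypothesis Pol_x : forall p, Pol (x p).
Hypothesis Pol_natV : forall m, Pol (m.+1%:R^-1).
Hypothesis Pol_pm : forall s f, Pol f -> Pol (pm s f).
Hypothesis Pol_diff : forall p q f, p != q -> Pol f ->
  Pol ((x p - x q)^-1 * (f - pm (tperm p q) f)).

Variables (V : lmodType K) (pv : {perm I} -> V -> V).
Hypothesis pv1 : forall v, pv 1%g v = v.
Hypothesis pvM : forall s t v, s \in G -> t \in G ->
  pv (s * t)%g v = pv t (pv s v).
Hypothesis pvD : forall s, {morph pv s : u v / u + v}.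
Hypothesis pvZ : forall s f v, pv s (f *: v) = pm s f *: pv s v.

Lemma sum_perm_ddiff w v : all adjacent w ->
  \sum_(s in G) pv s (foldr (ddiff pv) v w) =
  alt pv (foldr dK Delta (rev w) *: v).
Proof.
have -> u : \sum_(s in G) pv s u = alt pv (Delta *: u).
  by apply: eq_bigr => s _; rewrite scalerA mulVf ?Delta_neq0 // scale1r.
elim: w Delta => [//|pq w IH] f /= /andP[a aw].
by rewrite alt_ddiff // IH // rev_cons foldr_rcons.
Qed.

Variables (L : V -> Prop) (B : K -> Prop) (v : V).
Hypothesis L0 : L 0.
Hypothesis LD : forall u w, L u -> L w -> L (u + w).
Hypothesis LZ : forall b u, B b -> L u -> L (b *: u).
Hypothesis B_Pol : forall f, Pol f -> B f.
Hypothesis B_split : forall b, B b ->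
  exists c g, [/\ invariant c, B c, Pol g & b = c * g].

(** [B_split] moves the denominators into an invariant factor, which leaves [alt]. For the
    polynomial factor, [Delta_span] applies, its coefficients being invariant as well. *)
Lemma lattice_alt :
  (forall s, s \in G -> L (alt pv (Dn s Delta *: v))) ->
  forall b, B b -> L (alt pv (b *: v)).
Proof.
move=> Lv b /B_split[c [g [ic Bc Pg ->]]].
rewrite -scalerA altZ //; apply: LZ => {c ic Bc} //.
have [w0 w0G w0_dec] := exists_longest.
apply: (Delta_span w0G w0_dec PolB PolM Pol_x Pol_natV Pol_diff
  (P := fun f => L (alt pv (f *: v)))) Pg => [|f h Lf Lh|c s sG Pc ic].
- by rewrite scale0r alt0.
- by rewrite scalerDl altD //; apply: LD.
- by rewrite -scalerA altZ //; apply: LZ; [apply: B_Pol | apply: Lv].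
Qed.

(** Signed averaging over the stabilizer of v. When s fixes v, the vector s(f) v equals s(f v), so
    its alternating sum is that of f v times the sign of s, and every term of the average
    contributes equally. *)
Lemma antisymmetrize f : Pol f -> exists g,
  [/\ Pol g, forall s, s \in G -> pv s v = v -> pm s g = (-1) ^+ s * g
    & alt pv (f *: v) = alt pv (g *: v)].
Proof.
move=> Pf; pose St := [set s in G | pv s v == v].
have [StG Stv] : (forall s, s \in St -> s \in G) /\ (forall s, s \in St -> pv s v = v).
  by split=> s; rewrite inE => /andP[] // _ /eqP.
have Pneg h : Pol h -> Pol (- h) by rewrite -sub0r; apply: PolB; apply: (Pol0 PolB).
have Psum : Pol (\sum_(s in St) (-1) ^+ s * pm s f).
  apply: (big_ind Pol) => [|g h Pg Ph|s _]; first exact: Pol0.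
    by rewrite -[h]opprK; apply: PolB => //; apply: Pneg.
  by case: (odd_perm s); rewrite ?expr0 ?expr1 ?mulN1r ?mul1r;
     [apply: Pneg|]; apply: Pol_pm.
have St1 : 1%g \in St by rewrite inE block_perm1 pv1 eqxx.
have St_gt0 : (0 < #|St|)%N by apply/card_gt0P; exists 1%g.
pose N : K := #|St|%:R.
have N0 : N != 0 by rewrite /N -(prednK St_gt0) K_char0.
exists (N^-1 * \sum_(s in St) (-1) ^+ s * pm s f); split.
- by apply: PolM => //; rewrite /N -(prednK St_gt0).
- move=> t tG tv; rewrite rmorphM fmorphV rmorph_nat rmorph_sum mulrCA.
  congr (_ * _); rewrite mulr_sumr [RHS](reindex_inj (mulIg t)) /=.
  apply: eq_big => [s|s _].
    have tVG := block_permV tG.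
    rewrite [LHS]in_set [RHS]in_set; apply/idP/idP => /andP[sG /eqP sv].
      by rewrite block_permM // pvM // sv tv eqxx.
    have sG' : s \in G by rewrite -(mulgK t s) block_permM.
    rewrite sG' /= -[pv s v]pv1 -(mulgV t) pvM // -[pv t (pv s v)]pvM // sv.
    by rewrite -{1}tv -pvM // mulgV pv1.
  rewrite rmorphM rmorph_sign -pmM mulrA; congr (_ * _).
  by rewrite odd_permM signr_addb mulrCA -signr_addb addbb mulr1.
- have ic : invariant N^-1 by apply: invariantV; apply: invariant_nat.
  rewrite -scalerA [RHS]altZ // scaler_suml alt_sum //.
  rewrite [in RHS](eq_bigr (fun _ => alt pv (f *: v))) => [|s sSt].
    by rewrite sumr_const -scaler_nat scalerA mulVf ?scale1r.
  rewrite -scalerA -[in LHS](Stv s sSt) -pvZ.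
  have is_ : invariant ((-1) ^+ s : K) by move=> u _; rewrite rmorph_sign.
  by rewrite altZ // alt_perm ?StG // scalerA -expr2 sqrr_sign scale1r.
Qed.

Variable E : V -> V.
Hypothesis E_lin : forall f u w, E (f *: u + w) = f *: E u + E w.
Hypothesis E_pv : forall s u, s \in G -> E (pv s u) = pv s (E u).

Lemma E_scale f u : E (f *: u) = f *: E u.
Proof.
have E0 : E 0 = 0.
  have := E_lin 1 0 0; rewrite !scale1r addr0 => /eqP.
  by rewrite -[X in X == _]addr0 (inj_eq (addrI _)) eq_sym => /eqP.
by rewrite -[f *: u]addr0 E_lin E0 addr0.
Qed.

Lemma E_alt u : E (alt pv u) = alt pv (E u).
Proof.
have E0 : E 0 = 0 by rewrite -[X in E X](scale0r 0) E_scale scale0r.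
have ED : {morph E : u w / u + w}.
  by move=> a b; have := E_lin 1 a b; rewrite !scale1r.
rewrite /alt (big_morph E ED E0); apply: eq_bigr => s sG.
by rewrite E_pv // E_scale.
Qed.

End LatticeCore.

Section LatticeStable.
Variable Pol : K -> Prop.
Hypothesis PolB : forall f g, Pol f -> Pol g -> Pol (f - g).
Hypothesis PolM : forall f g, Pol f -> Pol g -> Pol (f * g).
Hypothesis Pol_x : forall p, Pol (x p).
Hypothesis Pol_natV : forall m, Pol (m.+1%:R^-1).
Hypothesis Pol_pm : forall s f, Pol f -> Pol (pm s f).
Hypothesis Pol_diff : forall p q f, p != q -> Pol f ->
  Pol ((x p - x q)^-1 * (f - pm (tperm p q) f)).
Variables (V : lmodType K) (pv : {perm I} -> V -> V).
Hypothesis pv1 : forall v, pv 1%g v = v.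
Hypothesis pvM : forall s t v, s \in G -> t \in G ->
  pv (s * t)%g v = pv t (pv s v).
Hypothesis pvD : forall s, {morph pv s : u v / u + v}.
Hypothesis pvZ : forall s f v, pv s (f *: v) = pm s f *: pv s v.
Variable B : K -> Prop.
Hypothesis B_Pol : forall f, Pol f -> B f.
Hypothesis B_split : forall b, B b ->
  exists c g, [/\ invariant c, B c, Pol g & b = c * g].
Variables (Z : Type) (T : Z -> V) (L : V -> Prop).
Hypothesis L0 : L 0.
Hypothesis LD : forall u w, L u -> L w -> L (u + w).
Hypothesis LZ : forall b u, B b -> L u -> L (b *: u).
Hypothesis L_word : forall w z, all adjacent w ->
  (forall w', all adjacent w' -> wperm w' = wperm w -> (size w <= size w')%N) ->
  L (\sum_(s in G) pv s (foldr (ddiff pv) (T z) w)).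

Lemma lattice_alt_basis b z : B b -> L (alt pv (b *: T z)).
Proof.
apply: (lattice_alt PolB PolM Pol_x Pol_natV Pol_diff) => // s sG.
have [aw ws sw] := canonical_wordP sG.
(* The lattice is given by sums over reduced words. The word reversed here is reduced too, and
   [sum_perm_ddiff] reverses it back, which produces [Dn s Delta]. *)
rewrite -[X in _ X](_ : \sum_(t in G) pv t (foldr (ddiff pv) (T z)
  (rev (canonical_word s))) = _); last first.
  by rewrite sum_perm_ddiff ?all_rev // revK.
apply: L_word => [|w' aw' e]; first by rewrite all_rev.
rewrite size_rev sw -[s]invgK -ws -wperm_rev -e -wperm_rev -(size_rev w').
by apply: size_word_ge; rewrite all_rev.
Qed.

Variable E : V -> V.
Hypothesis E_lin : forall f u w, E (f *: u + w) = f *: E u + E w.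
Hypothesis E_pv : forall s u, s \in G -> E (pv s u) = pv s (E u).

Lemma lattice_stable w z (J : finType) (P : pred J) (c : J -> K) (y : J -> Z) :
  all adjacent w ->
  E (T z) = \sum_(j | P j) c j *: T (y j) ->
  (forall f j, P j -> Pol f ->
     (forall s, s \in G -> pv s (T z) = T z -> pm s f = (-1) ^+ s * f) ->
     B (f * c j)) ->
  L (E (\sum_(s in G) pv s (foldr (ddiff pv) (T z) w))).
Proof.
move=> aw ET Bc; rewrite sum_perm_ddiff //.
have PDelta : Pol Delta.
  apply: (big_ind Pol) => [|//|pq _]; last exact: PolB.
  by rewrite -[1]invr1 (_ : 1 = 1%:R) //; apply: Pol_natV.
have := Pol_foldr Pol_diff (w := rev w); rewrite all_rev => /(_ _ aw PDelta) Pf.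
(* This has to precede the application of [E]: the symmetry used on the coefficients is the one
   under the stabilizer of [T z], not of the basis vectors in its image. *)
have [g [Pg gs ->]] := antisymmetrize PolB PolM Pol_natV Pol_pm pv1 pvM pvD pvZ (T z) Pf.
rewrite (E_alt E_lin E_pv) (E_scale E_lin) ET scaler_sumr alt_sum //.
apply: (big_ind L) => // j Pj; rewrite scalerA.
by apply: lattice_alt_basis; apply: Bc.
Qed.

End LatticeStable.
End NilHecke.
End BlockPermutations.
Local Open Scope ring_scope.

(** * Substitutions in rational functions *)

Lemma frac_repr (R : idomainType) (f : {fraction R}) :
  f = (FracField.tofrac \n_(generic_quotient.repr f))
        / (FracField.tofrac \d_(generic_quotient.repr f)).
Proof.
rewrite -[LHS]generic_quotient.reprK; set r := generic_quotient.repr f.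
unlock FracField.tofrac.
rewrite -[X in _ = _ * X]FracField.pi_inv -[RHS]FracField.pi_mul.
rewrite /FracField.mulf /FracField.invf !numden_Ratio ?oner_eq0 ?denom_ratioP //.
by rewrite mulr1 mul1r Ratio_numden.
Qed.

Lemma subr_div (F : fieldType) (a b c d : F) :
  b != 0 -> d != 0 -> a / b - c / d = (a * d - c * b) / (b * d).
Proof. by move=> b0 d0; field; rewrite b0 d0. Qed.

Lemma div_eq (F : fieldType) (a b c d : F) :
  b != 0 -> d != 0 -> a * d = c * b -> a / b = c / d.
Proof. by move=> b0 d0 e; apply/eqP; rewrite eqr_div // e. Qed.

Lemma div_eqV (F : fieldType) (a b c d : F) :
  b != 0 -> d != 0 -> a / b = c / d -> a * d = c * b.
Proof. by move=> b0 d0 /eqP; rewrite eqr_div // => /eqP. Qed.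

Lemma mulr_sub_mul (R : comRingType) (a b c d : R) :
  a * b - c * d = (a - c) * b + c * (b - d).
Proof. by ring. Qed.

Section FractionSubstitution.
Variables (R : idomainType) (K : fieldType) (j : {rmorphism R -> K}).
Variables (num den : K -> R) (e : {rmorphism R -> R}) (h : K -> K).
Hypothesis j_inj : injective j.
Hypothesis e_inj : injective e.
Hypothesis den_neq0 : forall f, den f != 0.
Hypothesis num_den : forall f, f = j (num f) / j (den f).
Hypothesis hE : forall f, h f = j (e (num f)) / j (e (den f)).

Let j_neq0 g : g != 0 -> j g != 0.
Proof. by rewrite -[X in _ -> _ != X](rmorph0 j) (inj_eq j_inj). Qed.

Let e_neq0 g : g != 0 -> e g != 0.
Proof. by rewrite -[X in _ -> _ != X](rmorph0 e) (inj_eq e_inj). Qed.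

(** An injective substitution keeps denominators nonzero and preserves cross-multiplied equalities,
    so the representative chosen by [num] and [den] does not matter. *)
Lemma subst_frac f g : g != 0 -> h (j f / j g) = j (e f) / j (e g).
Proof.
move=> g0; rewrite hE; have := num_den (j f / j g).
set n := num _; set d := den _; have d0 : d != 0 := den_neq0 _.
move/div_eqV; rewrite !j_neq0 // -!rmorphM => /(_ isT isT)/j_inj e2.
by apply: div_eq; rewrite ?j_neq0 ?e_neq0 // -!rmorphM e2.
Qed.

Lemma subst_frac_embed f : h (j f) = j (e f).
Proof.
have -> : j f = j f / j 1 by rewrite rmorph1 divr1.
by rewrite subst_frac ?oner_neq0 // !rmorph1 divr1.
Qed.

Lemma subst_frac_zmod : zmod_morphism h.
Proof.
move=> u v; rewrite [u]num_den [v]num_den.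
move: (den_neq0 u) (den_neq0 v) => b0 d0.
rewrite subr_div ?j_neq0 // -!rmorphM -rmorphB !subst_frac ?mulf_neq0 //.
by rewrite subr_div ?j_neq0 ?e_neq0 // -!(rmorphM, rmorphB) /= !(rmorphM, rmorphB).
Qed.

Lemma subst_frac_monoid : monoid_morphism h.
Proof.
split; first by rewrite -(rmorph1 j) subst_frac_embed rmorph1.
move=> u v; rewrite [u]num_den [v]num_den.
move: (den_neq0 u) (den_neq0 v) => b0 d0.
rewrite mulf_div -!rmorphM !subst_frac ?mulf_neq0 //.
by rewrite mulf_div !rmorphM.
Qed.

End FractionSubstitution.

Section Substitution.
Variables (C : fieldType) (n : nat).
Implicit Types (phi psi : Sigma n -> Cpoly C n).

Definition ev phi (f : Cpoly C n) : Cpoly C n :=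
  comp_mpoly [tuple phi (enum_val i) | i < #|Sigma n|] f.

Fact ev_zmod phi : zmod_morphism (ev phi).
Proof. by move=> f g; rewrite /ev comp_mpolyB. Qed.

Fact ev_monoid phi : monoid_morphism (ev phi).
Proof. by split; [exact: rmorph1 | move=> f g; exact: rmorphM]. Qed.

HB.instance Definition _ phi :=
  GRing.isZmodMorphism.Build (Cpoly C n) (Cpoly C n) (ev phi) (ev_zmod phi).
HB.instance Definition _ phi :=
  GRing.isMonoidMorphism.Build (Cpoly C n) (Cpoly C n) (ev phi) (ev_monoid phi).

Lemma evC phi c : ev phi (mpolyC _ c) = mpolyC _ c.
Proof. exact: comp_mpolyC. Qed.

Lemma evX phi p : ev phi (xpoly C p) = phi p.
Proof.
by rewrite /ev /xpoly comp_mpolyXU -tnth_nth tnth_mktuple enum_rankK.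
Qed.

Lemma Cpoly_ind (P : Cpoly C n -> Prop) :
  (forall c, P (mpolyC _ c)) -> (forall p, P (xpoly C p)) ->
  (forall f g, P f -> P g -> P (f + g)) ->
  (forall f g, P f -> P g -> P (f * g)) -> forall f, P f.
Proof.
move=> PC PX PD PM f; rewrite [f]mpolyE.
apply: (big_ind P) => [|//|m _]; first by rewrite -(mpolyC0 #|Sigma n| C).
rewrite -mul_mpolyC; apply: (PM) => //; rewrite mpolyXE_id.
apply: (big_ind P) => [||i _]; [by rewrite -(mpolyC1 #|Sigma n| C) | exact: PM |].
have Pi : P ('X_i) by have := PX (enum_val i); rewrite /xpoly enum_valK.
by elim: (m i) => [|k IH]; rewrite ?expr0 ?exprS -?(mpolyC1 #|Sigma n| C) //; apply: PM.
Qed.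

Lemma ev_comp phi psi f : ev psi (ev phi f) = ev (fun p => ev psi (phi p)) f.
Proof.
elim/Cpoly_ind: f => [c|p|f g IHf IHg|f g IHf IHg].
- by rewrite !evC.
- by rewrite !evX.
- by rewrite !rmorphD /= IHf IHg.
- by rewrite !rmorphM /= IHf IHg.
Qed.

Lemma ev_id f : ev (@xpoly C n) f = f.
Proof.
elim/Cpoly_ind: f => [c|p|f g IHf IHg|f g IHf IHg].
- by rewrite evC.
- by rewrite evX.
- by rewrite rmorphD /= IHf IHg.
- by rewrite rmorphM /= IHf IHg.
Qed.

Lemma eq_ev phi psi : phi =1 psi -> ev phi =1 ev psi.
Proof.
move=> e f; elim/Cpoly_ind: f => [c|p|f g IHf IHg|f g IHf IHg].
- by rewrite !evC.
- by rewrite !evX.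
- by rewrite !rmorphD /= IHf IHg.
- by rewrite !rmorphM /= IHf IHg.
Qed.

(** Congruence modulo d passes to sums and products. With d = x_p - x_q this gives both the
    polynomiality of divided differences and the factor theorem. *)
Lemma ev_sub_dvd phi psi d : (forall p, exists h, phi p - psi p = d * h) ->
  forall f, exists h, ev phi f - ev psi f = d * h.
Proof.
move=> H; elim/Cpoly_ind => [c|p|f g [h hE] [k kE]|f g [h hE] [k kE]].
- by exists 0; rewrite !evC subrr mulr0.
- by rewrite !evX.
- by exists (h + k); rewrite !rmorphD /= opprD addrACA hE kE mulrDr.
- exists (h * ev phi g + ev psi f * k); rewrite !rmorphM /= mulr_sub_mul hE kE mulrDr mulrA.
  by rewrite [_ * (d * k)]mulrCA.
Qed.

HB.instance Definition _ := GRing.isZmodMorphism.Build (Cpoly C n) (KX C n)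
  (@inK C n) (@tofrac_is_zmod_morphism (Cpoly C n)).
HB.instance Definition _ := GRing.isMonoidMorphism.Build (Cpoly C n) (KX C n)
  (@inK C n) (@tofrac_is_monoid_morphism (Cpoly C n)).

Lemma inK_neq0 (g : Cpoly C n) : g != 0 -> inK g != 0.
Proof. by rewrite /inK tofrac_eq0. Qed.

Lemma inKM (f g : Cpoly C n) : inK (f * g) = inK f * inK g.
Proof. exact: rmorphM. Qed.

Lemma inKD (f g : Cpoly C n) : inK (f + g) = inK f + inK g.
Proof. exact: rmorphD. Qed.

Lemma inKB (f g : Cpoly C n) : inK (f - g) = inK f - inK g.
Proof. exact: rmorphB. Qed.

Lemma inK_inj : injective (@inK C n).
Proof. by move=> f g /eqP; rewrite /inK tofrac_eq => /eqP. Qed.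

Lemma fraction_repr (f : KX C n) :
  f = inK (\n_(generic_quotient.repr f)) / inK (\d_(generic_quotient.repr f)).
Proof.
exact: frac_repr.
Qed.

Lemma fractionP (f : KX C n) :
  exists g h : Cpoly C n, h != 0 /\ f = inK g / inK h.
Proof.
by do 2!eexists; split; last exact: fraction_repr; apply: denom_ratioP.
Qed.

Section Automorphism.
Variables phi : Sigma n -> Cpoly C n.
Hypothesis ev_inj : injective (ev phi).

Let substKX_E f : substKX phi f =
  inK (ev phi (\n_(generic_quotient.repr f))) / inK (ev phi (\d_(generic_quotient.repr f))).
Proof. by []. Qed.

Let repr_den (f : KX C n) : \d_(generic_quotient.repr f) != 0.
Proof. exact: denom_ratioP. Qed.

Lemma substKX_inK f : substKX phi (inK f) = inK (ev phi f).
Proof. exact: (subst_frac_embed inK_inj ev_inj repr_den fraction_repr substKX_E). Qed.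

Lemma substKX_zmod : zmod_morphism (substKX phi).
Proof. exact: (subst_frac_zmod inK_inj ev_inj repr_den fraction_repr substKX_E). Qed.

Lemma substKX_monoid : monoid_morphism (substKX phi).
Proof. exact: (subst_frac_monoid inK_inj ev_inj repr_den fraction_repr substKX_E). Qed.

End Automorphism.
Lemma ev_perm_inj (s : {perm Sigma n}) : injective (ev (fun p => xpoly C (s p))).
Proof.
apply: (can_inj (g := ev (fun p => xpoly C ((s^-1)%g p)))) => f.
by rewrite ev_comp -[RHS]ev_id; apply: eq_ev => p; rewrite evX permK.
Qed.

Definition shift_poly (z : Zmu0 n) (p : Sigma n) : Cpoly C n :=
  xpoly C p + (\val z p)%:~R.

Lemma ev_shift_inj z : injective (ev (shift_poly z)).
Proof.
apply: (can_inj (g := ev (fun p => xpoly C p - (\val z p)%:~R))) => f.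
rewrite ev_comp -[RHS]ev_id; apply: eq_ev => p.
by rewrite rmorphD /= evX rmorph_int subrK.
Qed.

HB.instance Definition _ s := GRing.isZmodMorphism.Build (KX C n) (KX C n)
  (@permKX C n s) (substKX_zmod (ev_perm_inj (s := s))).
HB.instance Definition _ s := GRing.isMonoidMorphism.Build (KX C n) (KX C n)
  (@permKX C n s) (substKX_monoid (ev_perm_inj (s := s))).
HB.instance Definition _ z := GRing.isZmodMorphism.Build (KX C n) (KX C n)
  (@shiftKX C n z) (substKX_zmod (ev_shift_inj (z := z))).
HB.instance Definition _ z := GRing.isMonoidMorphism.Build (KX C n) (KX C n)
  (@shiftKX C n z) (substKX_monoid (ev_shift_inj (z := z))).

Lemma permKX_inK (s : {perm Sigma n}) f : permKX s (inK f) = inK (ev (fun p => xpoly C (s p)) f).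
Proof. exact: substKX_inK (@ev_perm_inj s) f. Qed.

Lemma permKX_x (s : {perm Sigma n}) (p : Sigma n) : permKX s (xK C p) = xK C (s p).
Proof. by rewrite /xK permKX_inK evX. Qed.

Lemma shiftKX_inK z f : shiftKX z (inK f) = inK (ev (shift_poly z) f).
Proof. exact: substKX_inK (@ev_shift_inj z) f. Qed.

Lemma shiftKX_x (z : Zmu0 n) (p : Sigma n) : shiftKX z (xK C p) = xK C p + (\val z p)%:~R.
Proof. by rewrite /xK shiftKX_inK evX rmorphD rmorph_int. Qed.

Lemma permKX_frac (s : {perm Sigma n}) f g : permKX s (inK f / inK g) =
  inK (ev (fun p => xpoly C (s p)) f) / inK (ev (fun p => xpoly C (s p)) g).
Proof. by rewrite (fmorph_div (permKX s)) /= !permKX_inK. Qed.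

Lemma shiftKX_frac (z : Zmu0 n) f g : shiftKX z (inK f / inK g) =
  inK (ev (shift_poly z) f) / inK (ev (shift_poly z) g).
Proof. by rewrite (fmorph_div (shiftKX z)) /= !shiftKX_inK. Qed.

Lemma permKX_mul (s : {perm Sigma n}) (f g : KX C n) :
  permKX s (f * g) = permKX s f * permKX s g.
Proof. exact: (rmorphM (permKX s)). Qed.

Lemma permKX1 (f : KX C n) : permKX 1%g f = f.
Proof.
have [a [b [_ ->]]] := fractionP f; rewrite permKX_frac.
have e g : ev (fun p => xpoly C ((1%g : {perm Sigma n}) p)) g = g.
  by rewrite -[RHS]ev_id; apply: eq_ev => p; rewrite perm1.
by rewrite !e.
Qed.

Lemma permKXM (s t : {perm Sigma n}) (f : KX C n) :
  permKX (s * t)%g f = permKX t (permKX s f).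
Proof.
have [a [b [_ ->]]] := fractionP f; rewrite !permKX_frac.
have e g : ev (fun p => xpoly C (t p)) (ev (fun p => xpoly C (s p)) g) =
    ev (fun p => xpoly C ((s * t)%g p)) g.
  by rewrite ev_comp; apply: eq_ev => p; rewrite evX permM.
by rewrite !e.
Qed.

Lemma xK_inj : injective (@xK C n).
Proof.
move=> p q /inK_inj e; apply/eqP; apply: contraT => ne.
have := congr1 (ev (fun r => (r == p)%:R)) e; rewrite !evX eqxx eq_sym (negPf ne).
by move/eqP; rewrite oner_eq0.
Qed.

Lemma polynomials_C (c : C) : polynomials (@Cconst C n c).
Proof. by exists (mpolyC _ c). Qed.

Lemma polynomials_inK (g : Cpoly C n) : polynomials (inK g).
Proof. by exists g. Qed.

Lemma polynomialsD (f g : KX C n) :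
  polynomials f -> polynomials g -> polynomials (f + g).
Proof. by move=> [a ->] [b ->]; exists (a + b); rewrite inKD. Qed.

Lemma polynomialsB (f g : KX C n) :
  polynomials f -> polynomials g -> polynomials (f - g).
Proof. by move=> [a ->] [b ->]; exists (a - b); rewrite inKB. Qed.

Lemma polynomialsM (f g : KX C n) :
  polynomials f -> polynomials g -> polynomials (f * g).
Proof. by move=> [a ->] [b ->]; exists (a * b); rewrite inKM. Qed.

Lemma polynomials_int (a : int) : polynomials (a%:~R : KX C n).
Proof. by exists a%:~R; rewrite rmorph_int. Qed.

Lemma polynomials_perm (s : {perm Sigma n}) (f : KX C n) : polynomials f -> polynomials (permKX s f).
Proof. by move=> [a ->]; rewrite permKX_inK; apply: polynomials_inK. Qed.

Lemma polynomials_diff (p q : Sigma n) (f : KX C n) : p != q -> polynomials f ->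
  polynomials ((xK C p - xK C q)^-1 * (f - permKX (tperm p q) f)).
Proof.
move=> pq [a ->]; rewrite permKX_inK -{1}(ev_id a) -inKB.
have [|h ->] := @ev_sub_dvd (@xpoly C n) (fun r => xpoly C (tperm p q r))
  (xpoly C p - xpoly C q) _ a.
  move=> r; case: tpermP => [->|->|_ _]; last by exists 0; rewrite subrr mulr0.
    by exists 1; rewrite mulr1.
  by exists (-1); rewrite mulrN1 opprB.
exists h; rewrite inKM inKB mulKf // subr_eq0; apply: contraNneq pq => e.
by apply/eqP; apply: xK_inj.
Qed.

Lemma ev_dvd_root (p q : Sigma n) f :
  ev (fun r => xpoly C (if r == p then q else r)) f = 0 ->
  exists h, f = (xpoly C p - xpoly C q) * h.
Proof.
move=> e; have [|h hE] := @ev_sub_dvd (@xpoly C n)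
    (fun r => xpoly C (if r == p then q else r)) (xpoly C p - xpoly C q) _ f.
  move=> r; case: eqP => [->|_]; first by exists 1; rewrite mulr1.
  by exists 0; rewrite subrr mulr0.
by exists h; rewrite -hE e subr0 ev_id.
Qed.

(** After division by x_p - x_q the quotient still vanishes at x_p = x_r for the other r, because
    x_r - x_q is nonzero in the integral domain of polynomials. *)
Lemma prod_dvd_roots (p : Sigma n) (J : seq (Sigma n)) f :
  uniq J -> p \notin J ->
  (forall q, q \in J -> ev (fun r => xpoly C (if r == p then q else r)) f = 0) ->
  exists h, f = (\prod_(q <- J) (xpoly C p - xpoly C q)) * h.
Proof.
elim: J f => [|q J IH] f /=; first by exists f; rewrite big_nil mul1r.
rewrite inE negb_or => /andP[qJ uJ] /andP[pq pJ] H.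
have [h fE] := ev_dvd_root (H q (mem_head _ _)).
have [//|//||k hE] := IH h.
  move=> r rJ; have := H r; rewrite inE rJ orbT => /(_ isT) /eqP.
  have /negPf qp : q != p by rewrite eq_sym.
  rewrite fE rmorphM rmorphB /= !evX eqxx qp mulf_eq0.
  have /negPf-> : xpoly C r - xpoly C q != 0.
    rewrite subr_eq0; apply: contraNneq qJ => e.
    by have /xK_inj <- : xK C r = xK C q by rewrite /xK e.
  by move/eqP.
by exists k; rewrite big_cons fE hE mulrA.
Qed.

End Substitution.

(** * The blocks and the big module *)

Section Blocks.
Variables (n : nat) (eta : 'I_n -> seq nat).

Lemma Sigma_eq (p q : Sigma n) : row_of p = row_of q -> pos_of p = pos_of q -> p = q.
Proof.
case: p q => [k i] [l j]; rewrite /row_of /pos_of /= => e; subst l => e.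
by congr existT; apply: val_inj.
Qed.

Definition block_key (p : Sigma n) : 'I_n * nat :=
  (row_of p, reshape_index (eta (row_of p)) (pos_of p)).

Lemma same_block_key p q : same_block eta p q = (block_key p == block_key q).
Proof. by rewrite /same_block xpair_eqE. Qed.

Lemma same_block_refl : reflexive (same_block eta).
Proof. by move=> p; rewrite same_block_key. Qed.

Lemma same_block_sym p q : same_block eta p q = same_block eta q p.
Proof. by rewrite !same_block_key eq_sym. Qed.

Lemma same_block_trans : transitive (same_block eta).
Proof. by move=> q p r; rewrite !same_block_key => /eqP -> /eqP ->. Qed.

Lemma same_block_row p q : same_block eta p q -> row_of p = row_of q.
Proof. by case/andP => /eqP. Qed.

Lemma same_block_pos_inj p q : same_block eta p q -> pos_of p = pos_of q -> p = q.
Proof. by move/same_block_row; apply: Sigma_eq. Qed.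

(** [reshape_index] is monotone in the position, so equal values at two positions of a row force the
    same value between them. *)
Lemma same_block_convex p q m : same_block eta p q ->
  (pos_of p < m < pos_of q)%N -> exists2 r, same_block eta p r & pos_of r = m.
Proof.
case: p q => [k i] [l j] /andP[/eqP /= e]; move: j; rewrite /row_of /pos_of /= in e *.
subst l => j /eqP ij /andP[im mj].
have mk : (m < k.+1)%N by apply: ltn_trans mj (ltn_ord j).
exists (Tagged (fun k : 'I_n => 'I_k.+1) (Ordinal mk)); last by [].
rewrite /same_block /row_of /pos_of /= eqxx /= in ij *.
have mono a b : (a <= b)%N -> (reshape_index (eta k) a <= reshape_index (eta k) b)%N.
  by rewrite (reshape_leq (eta k)) => /orP[/ltnW//|/andP[/eqP -> _]].
by rewrite eqn_leq mono ?(ltnW im) //= ij mono // ltnW.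
Qed.

Lemma S_etaP (s : {perm Sigma n}) :
  reflect (forall p, same_block eta p (s p)) (s \in S_eta eta).
Proof. exact: block_permsP. Qed.

Lemma S_eta_row s p : s \in S_eta eta -> row_of (s p) = row_of p.
Proof. by move=> /S_etaP /(_ p) /same_block_row. Qed.

Lemma S_etaV s : s \in S_eta eta -> (s^-1)%g \in S_eta eta.
Proof. exact: (block_permV same_block_sym). Qed.

Lemma S_etaM s t : s \in S_eta eta -> t \in S_eta eta -> (s * t)%g \in S_eta eta.
Proof. exact: (block_permM same_block_trans). Qed.

Lemma same_block_perm s p q : s \in S_eta eta ->
  same_block eta (s p) (s q) = same_block eta p q.
Proof. exact: (blk_perm same_block_sym same_block_trans). Qed.

Lemma val_to_Zmu0 (z : {ffun Sigma n -> int}) : top_zero z -> \val (to_Zmu0 z) = z.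
Proof. by move=> h; rewrite /to_Zmu0 insubdK. Qed.

Lemma top_zeroP (z : {ffun Sigma n -> int}) :
  reflect (forall p, (row_of p).+1 = n -> z p = 0) (top_zero z).
Proof.
apply: (iffP forallP) => H p.
  by move=> e; have := H p; rewrite e eqxx => /eqP.
by apply/implyP => /eqP /H ->.
Qed.

(** Elements of [S_eta] preserve rows, so the permuted family still vanishes on the top row and the
    default value of [to_Zmu0] is not reached. *)
Lemma val_perm_family s z p : s \in S_eta eta ->
  \val (perm_family s z) p = \val z ((s^-1)%g p).
Proof.
move=> sG; rewrite val_to_Zmu0 ?ffunE //; apply/top_zeroP => q e; rewrite ffunE.
by apply: (top_zeroP _ (valP z)); rewrite S_eta_row ?S_etaV.
Qed.

Lemma perm_family1 (z : Zmu0 n) : perm_family 1%g z = z.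
Proof.
apply: val_inj; rewrite val_to_Zmu0.
  by apply/ffunP => p; rewrite ffunE invg1 perm1.
by apply/top_zeroP => p e; rewrite ffunE invg1 perm1; apply: (top_zeroP _ (valP z)).
Qed.

Lemma perm_familyM s t z : s \in S_eta eta -> t \in S_eta eta ->
  perm_family (s * t)%g z = perm_family t (perm_family s z).
Proof.
move=> sG tG; apply: val_inj; apply/ffunP => p.
by rewrite !val_perm_family ?S_etaM // invMg permM.
Qed.

Lemma perm_family_tperm (z : Zmu0 n) p q : same_block eta p q ->
  \val z p = \val z q -> perm_family (tperm p q) z = z.
Proof.
move=> pq e; have tG := block_tperm same_block_refl same_block_sym pq.
apply: val_inj; apply/ffunP => r; rewrite val_perm_family // tpermV.
by case: tpermP => [->|->|//].
Qed.

End Blocks.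

(** * Semilinear maps on a free module *)

Section SemilinearExtension.
Variables (K : fieldType) (Z : choiceType).
Implicit Types (u v : {malg K[Z]}).
Local Notation fsetZ := (finmap.finset_of (Phant Z)).
Local Notation U z := (monalg.mkmalgU z (1 : K)).

Lemma malg_coef v (E : fsetZ) : finmap.fsubset (monalg.msupp v) E ->
  v = \sum_(z <- finmap.enum_fset E) monalg.mcoeff z v *: U z.
Proof.
move=> sE; rewrite [LHS](monalg.monalgEw sE); apply: eq_bigr => z _.
by apply/monalg.malgP => y; rewrite monalg.mcoeffZ !monalg.mcoeffU mulrnAr mulr1.
Qed.

Lemma malg_basis_ind (P : {malg K[Z]} -> Prop) :
  P 0 -> (forall u v, P u -> P v -> P (u + v)) -> (forall f z, P (f *: U z)) ->
  forall v, P v.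
Proof.
move=> P0 PD PT v; rewrite (malg_coef (finmap.fsubset_refl (monalg.msupp v))).
by apply: (big_ind P).
Qed.

Variables (h : {rmorphism K -> K}) (a : Z -> Z).

Definition semilinear_ext v : {malg K[Z]} :=
  \sum_(z <- finmap.enum_fset (monalg.msupp v)) h (monalg.mcoeff z v) *: U (a z).

(** Extra indices contribute zero; summing over a common finite set makes additivity and
    semilinearity termwise. *)
Lemma semilinear_ext_wide v (E : fsetZ) : finmap.fsubset (monalg.msupp v) E ->
  semilinear_ext v =
    \sum_(z <- finmap.enum_fset E) h (monalg.mcoeff z v) *: U (a z).
Proof.
move=> sE; apply: finmap.big_fset_incl => // z _ /monalg.mcoeff_outdom ->.
by rewrite rmorph0 scale0r.
Qed.

Lemma semilinear_extD u v :
  semilinear_ext (u + v) = semilinear_ext u + semilinear_ext v.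
Proof.
rewrite (semilinear_ext_wide (finmap.fsubsetUl (monalg.msupp u) (monalg.msupp v))).
rewrite (semilinear_ext_wide (finmap.fsubsetUr (monalg.msupp u) (monalg.msupp v))).
rewrite (semilinear_ext_wide (monalg.msuppD_le u v)) -big_split.
by apply: eq_bigr => z _; rewrite /= monalg.mcoeffD rmorphD scalerDl.
Qed.

Lemma semilinear_extZ f v : semilinear_ext (f *: v) = h f *: semilinear_ext v.
Proof.
rewrite (semilinear_ext_wide (monalg.msuppZ_le f v)) /semilinear_ext scaler_sumr.
by apply: eq_bigr => z _; rewrite monalg.mcoeffZ rmorphM scalerA.
Qed.

Lemma semilinear_extU z : semilinear_ext (U z) = U (a z).
Proof.
rewrite (semilinear_ext_wide monalg.msuppU_le).
by rewrite finmap.big_seq_fset1 monalg.mcoeffUU rmorph1 scale1r.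
Qed.

End SemilinearExtension.

Section BigModuleAction.
Variables (C : fieldType) (n : nat).
Local Notation V := (VK C n).

Lemma permVKD s : {morph @permVK C n s : u v / u + v}.
Proof. exact: (semilinear_extD (permKX s) (perm_family s)). Qed.

Lemma permVKZ s f (v : V) : permVK s (f *: v) = permKX s f *: permVK s v.
Proof. exact: (semilinear_extZ (permKX s) (perm_family s)). Qed.

Lemma permVK_T s z : permVK s (basisT C z) = basisT C (perm_family s z) :> V.
Proof. exact: (semilinear_extU (permKX s) (perm_family s)). Qed.

Lemma VK_ind (P : V -> Prop) :
  P 0 -> (forall u v, P u -> P v -> P (u + v)) ->
  (forall f z, P (f *: basisT C z)) -> forall v, P v.
Proof. exact: malg_basis_ind. Qed.

Lemma permVK0 s : permVK s 0 = 0 :> V.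
Proof.
have := permVKZ s 0 0; rewrite (rmorph0 (permKX s)).
by rewrite [X in permVK s X]scale0r [RHS]scale0r.
Qed.

Lemma permVK1 (v : V) : permVK 1%g v = v.
Proof.
elim/VK_ind: v => [|u v IHu IHv|f z].
- exact: permVK0.
- by rewrite permVKD IHu IHv.
- by rewrite permVKZ permVK_T permKX1 perm_family1.
Qed.

Lemma permVKM (eta : 'I_n -> seq nat) s t (v : V) :
  s \in S_eta eta -> t \in S_eta eta -> permVK (s * t)%g v = permVK t (permVK s v).
Proof.
move=> sG tG; elim/VK_ind: v => [|u v IHu IHv|f z].
- by rewrite !permVK0.
- by rewrite !permVKD IHu IHv.
- by rewrite !permVKZ !permVK_T permKXM (perm_familyM _ sG tG).
Qed.

End BigModuleAction.

(** * The ring B_eta *)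

Lemma split_denominator (F : fieldType) (g d e : F) :
  e != 0 -> g / d = (d * e)^-1 * (g * e).
Proof. by move=> e0; rewrite invfM mulrACA -mulrA mulVf // mulr1 mulrC. Qed.

Lemma divNN (F : fieldType) (b d : F) : b / d = - b / - d.
Proof. by rewrite invrN mulrNN. Qed.

Lemma opp_sub3 (F : fieldType) (u v w : F) : - (u - v - w) = v - u - - w.
Proof. by ring. Qed.

Lemma cancel_factor (F : fieldType) (p h N e : F) :
  p != 0 -> p * h * (N / (p * e)) = h * N / e.
Proof. by move=> p0; rewrite invfM [N * _]mulrCA mulrACA mulfV // mul1r mulrA. Qed.

Lemma sub_add_sub (F : fieldType) (u v a b : F) :
  (u + a) - (v + b) = u - v - (b - a).
Proof. by ring. Qed.

Lemma addr_sub_cancel (F : fieldType) (u v a : F) : (u + a) - (v + a) = u - v.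
Proof. by ring. Qed.

Section LocalizedRing.
Variables (C : fieldType) (n : nat) (eta : 'I_n -> seq nat).
Local Notation x := (@xK C n).
Local Notation Beta := (@B_eta C n eta).

(** The denominators of the two successive localizations in one family, without an order on p and q.
    Unlike the ordered family it is visibly stable under [S_eta]. *)
Definition inverted (d : KX C n) : Prop :=
  exists (p q : Sigma n) (a : int),
    [/\ row_of p = row_of q, p != q, ((row_of p).+1 < n)%N,
        (a != 0) || ~~ same_block eta p q & d = x p - x q - a%:~R].

Lemma inverted_neq0 d : inverted d -> d != 0.
Proof.
move=> [p [q [a [_ pq _ _ ->]]]]; have qp : (q == p) = false.
  by rewrite eq_sym; apply: negbTE.
rewrite /xK -inKB -(rmorph_int (@inK C n)) -inKB; apply: inK_neq0.
apply/eqP => e.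
(* Setting x_p to c and all other variables to zero would make every c equal to a; the values 1 and
   0 of c contradict each other. *)
have H (c : Cpoly C n) : c = a%:~R.
  have := congr1 (ev (fun r => if r == p then c else 0)) e.
  rewrite !rmorphB /= !evX eqxx qp rmorph_int rmorph0 subr0 => /eqP.
  by rewrite subr_eq0 => /eqP.
have := oner_neq0 (Cpoly C n); rewrite (H 1) -(H 0) eqxx.
exact: notF.
Qed.

Lemma inverted_perm s d : s \in S_eta eta -> inverted d -> inverted (permKX s d).
Proof.
move=> sG [p [q [a [rpq pq ptop apq ->]]]]; exists (s p), (s q), a; split.
- by rewrite !(S_eta_row _ sG).
- by rewrite (inj_eq perm_inj).
- by rewrite (S_eta_row _ sG).
- by rewrite (same_block_perm _ _ sG).
- by rewrite !(rmorphB (permKX s)) /= !permKX_x (rmorph_int (permKX s)).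
Qed.

Lemma localization_base (A D : KX C n -> Prop) f : A f -> localization A D f.
Proof. by move=> Af; exists f, [::]; rewrite big_nil divr1. Qed.

Lemma localization_div (A D : KX C n -> Prop) f d :
  localization A D f -> D d -> localization A D (f / d).
Proof.
move=> [a [ds [Aa Dds ->]]] Dd; exists a, (d :: ds); split=> //.
  by move=> e; rewrite inE => /orP[/eqP -> //|/Dds].
by rewrite big_cons invfM mulrCA mulrC.
Qed.

Lemma localization_mul (A D : KX C n -> Prop) c f :
  (forall a, A a -> A (c * a)) -> localization A D f -> localization A D (c * f).
Proof.
move=> Ac [a [ds [Aa Dds ->]]]; exists (c * a), ds; split=> //; first exact: Ac.
exact: mulrA.
Qed.

Lemma B_eta_polynomial f : polynomials f -> Beta f.
Proof. by move=> Pf; do 2!apply: localization_base. Qed.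

Lemma B_eta_mul c f : polynomials c -> Beta f -> Beta (c * f).
Proof.
move=> Pc; apply: localization_mul => a; apply: localization_mul => b.
exact: polynomialsM.
Qed.

Lemma B_etaN f : Beta f -> Beta (- f).
Proof.
move=> Bf; rewrite -mulN1r; apply: B_eta_mul => //.
by exists (- 1); rewrite rmorphN1.
Qed.

Lemma B_ring_div f d : (exists (p q : Sigma n) (a : int),
      [/\ row_of p = row_of q, (pos_of p < pos_of q)%N,
          ((row_of p).+1 < n)%N, a != 0 & d = x p - x q - a%:~R]) ->
  Beta f -> Beta (f / d).
Proof.
move=> Dd [a [ds [Aa Dds ->]]]; exists (a / d), ds; split=> //.
  exact: localization_div.
by rewrite mulrAC.
Qed.

Lemma B_eta_div f d : inverted d -> Beta f -> Beta (f / d).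
Proof.
move=> [p [q [a [rpq pq ptop apq ->]]]] Bf.
have [a0|a0] := eqVneq a 0; last first.
  have : pos_of p != pos_of q by apply: contraNneq pq => /(Sigma_eq rpq) ->.
  rewrite neq_ltn => /orP[lt|lt].
    by apply: B_ring_div => //; exists p, q, a.
  rewrite divNN; apply: B_ring_div; last exact: B_etaN.
  exists q, p, (- a); split; rewrite ?oppr_eq0 -?rpq //.
  by rewrite rmorphN; apply: opp_sub3.
rewrite a0 eqxx /= in apq; rewrite a0 subr0; apply: localization_div => //.
by exists p, q.
Qed.

Lemma B_eta_inv_prod (J : Type) (r : seq J) (P : pred J) (F : J -> KX C n) f :
  (forall j, P j -> inverted (F j)) -> Beta f -> Beta (f / \prod_(j <- r | P j) F j).
Proof.
move=> H; elim: r f => [|j r IH] f Bf; first by rewrite big_nil divr1.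
rewrite big_cons; case: ifP => // Pj; last exact: IH.
rewrite invfM mulrA; apply: IH; apply: B_eta_div => //; exact: H.
Qed.

Lemma B_etaP f : Beta f -> exists (g : KX C n) (ds : seq (KX C n)),
  [/\ polynomials g, forall d, d \in ds -> inverted d & f = g / \prod_(d <- ds) d].
Proof.
move=> [a [ds [[g [es [Pg Des ->]] Dds ->]]]]; exists g, (es ++ ds); split=> //.
  move=> d; rewrite mem_cat => /orP[/Des|/Dds].
    move=> [p [q [b [rpq lt ptop b0 ->]]]]; exists p, q, b; split=> //.
      by apply: contraTneq lt => ->; rewrite ltnn.
    by rewrite b0.
  move=> [p [q [rpq ptop npq ->]]]; exists p, q, 0; split=> //.
    by apply: contraNneq npq => ->; apply: same_block_refl.
  by rewrite subr0.
by rewrite big_cat invfM mulrA.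
Qed.

Lemma B_etaM f g : Beta f -> Beta g -> Beta (f * g).
Proof.
move=> /B_etaP[a [ds [Pa Dds ->]]] Bg; rewrite mulrAC big_seq.
by apply: B_eta_inv_prod => //; apply: B_eta_mul.
Qed.

(** The denominator is completed to its norm [D], the product of its conjugates under [S_eta]. The
    norm is invariant and still a product of inverted elements; the remaining conjugates [E] join
    the numerator. *)
Lemma B_eta_split b : Beta b -> exists c g,
  [/\ forall s, s \in S_eta eta -> permKX s c = c, Beta c, polynomials g & b = c * g].
Proof.
move=> /B_etaP[g [ds [Pg Dds ->]]]; set d := \prod_(d <- ds) d.
pose D := \prod_(s in S_eta eta) permKX s d.
have G1 : 1%g \in S_eta eta := block_perm1 (@same_block_refl n eta).
have d0 : d != 0.
  by rewrite /d prodf_seq_neq0; apply/allP => e /Dds; apply: inverted_neq0.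
pose E := \prod_(s in S_eta eta | s != 1%g) permKX s d.
have DE : D = d * E by rewrite /D (bigD1 1%g) //= permKX1.
have E0 : E != 0.
  by apply/prodf_neq0 => s _; rewrite (fmorph_eq0 (permKX s)).
have P1 : polynomials (1 : KX C n) by exists 1; rewrite rmorph1.
have Pd : polynomials d.
  rewrite /d big_seq; apply: (big_ind (@polynomials C n)) => [//||e /Dds].
    exact: polynomialsM.
  move=> [p [q [a [_ _ _ _ ->]]]].
  by apply: polynomialsB (polynomials_int _ _ _); apply: polynomialsB;
     apply: polynomials_inK.
have PE : polynomials E.
  apply: (big_ind (@polynomials C n)) => [//||s _]; first exact: polynomialsM.
  exact: polynomials_perm.
exists D^-1, (g * E); split.
- move=> s sG; rewrite (fmorphV (permKX s)) /=; congr (_^-1).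
  rewrite (rmorph_prod (permKX s)) /= [RHS](reindex_inj (mulIg s)) /=.
  apply: eq_big => [t|t _]; last by rewrite permKXM.
  apply/idP/idP => h; first exact: S_etaM.
  by rewrite -(mulgK s t); apply: S_etaM => //; apply: S_etaV.
- rewrite -div1r; have -> : D = \prod_(s in S_eta eta) \prod_(e <- ds | e \in ds) permKX s e.
    by apply: eq_bigr => s _; rewrite (rmorph_prod (permKX s)) big_seq.
  suff H r f : Beta f -> Beta (f / \prod_(s <- r | s \in S_eta eta)
      \prod_(e <- ds | e \in ds) permKX s e) by apply/H/B_eta_polynomial.
  elim: r f => [|s r IH] f Bf; first by rewrite big_nil divr1.
  rewrite big_cons; case: ifP => // sG; last exact: IH.
  rewrite invfM mulrA; apply: IH; apply: B_eta_inv_prod => // e /Dds.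
  exact: inverted_perm.
- exact: polynomialsM.
- by rewrite DE; apply: split_denominator.
Qed.

End LocalizedRing.

(** * Integrality of the Gelfand-Tsetlin coefficients *)

Section Coefficients.
Variables (C : fieldType) (n : nat) (eta : 'I_n -> seq nat).
Hypothesis C_char0 : forall m, m.+1%:R != 0 :> C.
Local Notation x := (@xK C n).
Local Notation Beta := (@B_eta C n eta).

(** Setting x_p = x_q makes the transposition trivial, so f becomes its own opposite, and 2 is
    invertible in characteristic zero. *)
Lemma antisymmetric_root (p q : Sigma n) (f : Cpoly C n) :
  permKX (tperm p q) (inK f) = - inK f ->
  ev (fun r => xpoly C (if r == p then q else r)) f = 0.
Proof.
rewrite permKX_inK -(rmorphN (@inK C n)) => /inK_inj.
move/(congr1 (ev (fun r => xpoly C (if r == p then q else r)))).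
rewrite ev_comp rmorphN /= (eq_ev (psi := fun r => xpoly C (if r == p then q else r))).
  move/eqP; rewrite -addr_eq0 -mulr2n -mulr_natl mulf_eq0 => /orP[|/eqP//].
  by rewrite -mpolyC_nat mpolyC_eq0 (negPf (C_char0 1)).
move=> r; rewrite evX; case: tpermP => [->|->|/eqP/negPf -> _].
- by rewrite eqxx; case: eqP.
- by rewrite eqxx; case: eqP.
- by [].
Qed.

(* The factors of the denominator that are not inverted in B_eta are the
   x_p - x_q with p, q in a block and z_p = z_q; they divide f. *)
Lemma B_eta_coefficient (z : Zmu0 n) (p : Sigma n) (f N : KX C n) :
  ((row_of p).+1 < n)%N -> polynomials f -> polynomials N ->
  (forall q, q != p -> same_block eta p q -> \val z q = \val z p ->
     permKX (tperm p q) f = - f) ->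
  Beta (f * (N / \prod_(q | (row_of q == row_of p) && (q != p))
    ((x p + (\val z p)%:~R) - (x q + (\val z q)%:~R)))).
Proof.
move=> ptop [f0 ->] PN anti.
pose J := [seq q <- index_enum (Sigma n) |
  [&& q != p, same_block eta p q & \val z q == \val z p]].
have [||q qJ|h f0E] := @prod_dvd_roots C n p J f0.
- exact/filter_uniq/index_enum_uniq.
- by rewrite mem_filter eqxx.
- move: qJ; rewrite mem_filter => /andP[/and3P[qp pq /eqP e] _].
  exact/antisymmetric_root/anti.
rewrite (bigID (fun q => same_block eta p q && (\val z q == \val z p))) /=.
have e1 : \prod_(q | [&& (row_of q == row_of p) && (q != p), same_block eta p q
      & \val z q == \val z p]) ((x p + (\val z p)%:~R) - (x q + (\val z q)%:~R)) =
      inK (\prod_(q <- J) (xpoly C p - xpoly C q)).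
  rewrite (rmorph_prod (@inK C n)) big_filter; apply: eq_big => [q|q].
    case: (boolP (same_block eta p q)) => [pq|]; last by rewrite !andbF.
    by rewrite (same_block_row pq) eqxx.
  by move=> /and3P[_ _ /eqP e]; rewrite e (rmorphB (@inK C n)) /=; apply: addr_sub_cancel.
rewrite e1 f0E inKM; set P1 := inK (\prod_(q <- J) _).
have P10 : P1 != 0.
  apply: inK_neq0; rewrite prodf_seq_neq0; apply/allP => q.
  rewrite mem_filter => /andP[/and3P[qp _ _] _] /=; rewrite subr_eq0.
  apply: contraNneq qp => e; apply/eqP; apply/esym/(@xK_inj C n).
  by rewrite /xK e.
rewrite (cancel_factor _ _ _ P10); apply: B_eta_inv_prod => [q|]; last first.
  by apply: B_eta_polynomial; apply: polynomialsM => //; exists h.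
move=> /andP[/andP[/eqP rq qp] H]; exists p, q, (\val z q - \val z p); split=> //.
- by rewrite eq_sym.
- by move: H; rewrite subr_eq0; case: (same_block eta p q); rewrite //= ?orbT // orbF.
- by rewrite rmorphB; apply: sub_add_sub.
Qed.

Lemma B_eta_antisymmetric (z : Zmu0 n) (p : Sigma n) (f N : KX C n) :
  ((row_of p).+1 < n)%N -> polynomials f -> polynomials N ->
  (forall s, s \in S_eta eta -> permVK s (basisT C z) = basisT C z ->
     permKX s f = (-1) ^+ s * f) ->
  Beta (f * (N / \prod_(q | (row_of q == row_of p) && (q != p))
    ((x p + (\val z p)%:~R) - (x q + (\val z q)%:~R)))).
Proof.
move=> ptop Pf PN anti; apply: B_eta_coefficient => // q qp pq e.
rewrite anti.
- by rewrite odd_tperm eq_sym qp expr1 mulN1r.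
- have tG := block_tperm (@same_block_refl n eta) (@same_block_sym n eta) pq.
  exact: tG.
- by rewrite permVK_T (perm_family_tperm pq) // e.
Qed.

(** Both sides substitute x_{s p} + z_p for x_p, because (s z)_{s p} = z_p. The equivariance of the
    Gelfand-Tsetlin coefficients follows from this. *)
Lemma shiftKX_permKX s (z : Zmu0 n) (f : KX C n) : s \in S_eta eta ->
  shiftKX (perm_family s z) (permKX s f) = permKX s (shiftKX z f).
Proof.
move=> sG; have [a [b [_ ->]]] := fractionP f.
rewrite permKX_frac shiftKX_frac shiftKX_frac permKX_frac.
have e g : ev (shift_poly C (perm_family s z)) (ev (fun p => xpoly C (s p)) g) =
    ev (fun p => xpoly C (s p)) (ev (shift_poly C z) g).
  rewrite !ev_comp; apply: eq_ev => p; rewrite evX /shift_poly.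
  by rewrite (val_perm_family _ _ sG) permK rmorphD /= evX rmorph_int.
by rewrite !e.
Qed.

Lemma polynomials_shift (z : Zmu0 n) p q :
  polynomials ((x p + (\val z p)%:~R) - (x q + (\val z q)%:~R)).
Proof.
by apply: polynomialsB; apply: polynomialsD (polynomials_int _ _ _);
   apply: polynomials_inK.
Qed.

Lemma polynomials_prod_shift (z : Zmu0 n) p (P : pred (Sigma n)) :
  polynomials (\prod_(q | P q) ((x p + (\val z p)%:~R) - (x q + (\val z q)%:~R))).
Proof.
apply: (big_ind (@polynomials C n)) => [||q _]; last exact: polynomials_shift.
  by exists 1; rewrite rmorph1.
exact: polynomialsM.
Qed.

Lemma shiftKX_prod_div (z : Zmu0 n) p (P Q : pred (Sigma n)) :
  shiftKX z (\prod_(q | P q) (x p - x q) / \prod_(q | Q q) (x p - x q)) =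
  \prod_(q | P q) ((x p + (\val z p)%:~R) - (x q + (\val z q)%:~R)) /
  \prod_(q | Q q) ((x p + (\val z p)%:~R) - (x q + (\val z q)%:~R)).
Proof.
rewrite (fmorph_div (shiftKX z)) /= !(rmorph_prod (shiftKX z)) /=.
by congr (_ / _); apply: eq_bigr => q _; rewrite (rmorphB (shiftKX z)) /= !shiftKX_x.
Qed.

Lemma perm_family_to_Zmu0 s (y y' : {ffun Sigma n -> int}) : s \in S_eta eta ->
  top_zero y -> (forall p, y' p = y ((s^-1)%g p)) ->
  perm_family s (to_Zmu0 y) = to_Zmu0 y'.
Proof.
move=> sG y0 yy'; apply: val_inj; apply/ffunP => p.
have y0' : top_zero y'.
  apply/top_zeroP => q e; rewrite yy'; apply: (top_zeroP _ y0).
  by rewrite (S_eta_row _ (S_etaV sG)).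
by rewrite (val_perm_family _ _ sG) !val_to_Zmu0.
Qed.

End Coefficients.

Lemma commute_add (V : zmodType) (E g : V -> V) u v :
  {morph E : a b / a + b} -> {morph g : a b / a + b} ->
  E (g u) = g (E u) -> E (g v) = g (E v) -> E (g (u + v)) = g (E (u + v)).
Proof. by move=> ED gD eu ev; rewrite gD !ED gD eu ev. Qed.

Lemma commute_scale (K : fieldType) (V : lmodType K) (E g : V -> V) (h : K -> K)
    f t u a b :
  (forall c v, E (c *: v) = c *: E v) -> (forall c v, g (c *: v) = h c *: g v) ->
  g t = u -> E u = a -> E t = b -> a = g b -> E (g (f *: t)) = g (E (f *: t)).
Proof. by move=> EZ gZ gt Eu Et e; rewrite gZ !EZ gZ gt Eu Et e. Qed.

(** Equivariance of an operator given by a formula on basis vectors: [a] acts on the summation index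
    and [gz] on the labels of the basis. *)
Lemma sum_permuted (K : fieldType) (V : lmodType K) (Z : Type) (T : Z -> V)
    (g : V -> V) (h : K -> K) (gz : Z -> Z) (J : finType) (P : pred J) (a : J -> J)
    (c c' : J -> K) (y y' : J -> Z) :
  {morph g : a b / a + b} -> (forall c v, g (c *: v) = h c *: g v) ->
  (forall z, g (T z) = T (gz z)) -> g 0 = 0 -> injective a ->
  (forall j, P (a j) = P j) ->
  (forall j, P j -> c' (a j) = h (c j)) -> (forall j, P j -> y' (a j) = gz (y j)) ->
  \sum_(j | P j) c' j *: T (y' j) = g (\sum_(j | P j) c j *: T (y j)).
Proof.
move=> gD gZ gT g0 ai Pa ca ya; rewrite (big_morph g gD g0) (reindex_inj ai).
by apply: eq_big => j; rewrite Pa // => Pj; rewrite ca // ya // gZ gT.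
Qed.

Lemma fold_linear (K : fieldType) (V : lmodType K) (L : V -> Prop) (B : K -> Prop)
    (D : V -> Prop) (E : V -> V) (s : seq (K * V)) :
  {morph E : a b / a + b} -> (forall c v, E (c *: v) = c *: E v) -> E 0 = 0 ->
  L 0 -> (forall u v, L u -> L v -> L (u + v)) ->
  (forall b v, B b -> L v -> L (b *: v)) ->
  (forall v, D v -> L (E v)) ->
  (forall c, c \in s -> B c.1 /\ D c.2) -> L (E (\sum_(c <- s) c.1 *: c.2)).
Proof.
move=> ED EZ E0 L0 LD LZ DL Hs; rewrite (big_morph E ED E0) big_seq.
apply: (big_ind L) => // c /Hs[Bc Dc]; rewrite EZ; apply: LZ => //; exact: DL.
Qed.

(** * Stability of the lattice *)

Section Lattice.
Variables (C : fieldType) (n : nat) (eta : 'I_n -> seq nat).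
Hypothesis C_char0 : forall m, m.+1%:R != 0 :> C.
Local Notation Beta := (@B_eta C n eta).
Local Notation L := (@L_eta C n eta).

Lemma L_eta0 : L 0.
Proof. by exists [::]; split; [|rewrite big_nil]. Qed.

Lemma L_etaD u v : L u -> L v -> L (u + v).
Proof.
move=> [s [Ls ->]] [t [Lt ->]]; exists (s ++ t); split; last by rewrite big_cat.
by move=> c; rewrite mem_cat => /orP[/Ls|/Lt].
Qed.

Lemma L_etaZ b v : Beta b -> L v -> L (b *: v).
Proof.
move=> Bb [s [Ls ->]]; exists [seq (b * c.1, c.2) | c <- s]; split.
  by move=> _ /mapP[c /Ls[Bc Dc] ->]; split=> //; apply: B_etaM.
rewrite big_map scaler_sumr; apply: eq_bigr => c _; exact: scalerA.
Qed.

Lemma L_eta_DT v : D_T eta v -> L v.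
Proof.
move=> Dv; exists [:: (1, v)]; split; last by rewrite big_seq1 scale1r.
move=> c; rewrite inE => /eqP ->; split=> //; apply: B_eta_polynomial.
by exists 1; rewrite rmorph1.
Qed.

Lemma KX_char0 m : m.+1%:R != 0 :> KX C n.
Proof.
rewrite -(rmorph_nat (@inK C n)); apply: inK_neq0.
by rewrite -mpolyC_nat mpolyC_eq0 C_char0.
Qed.

Lemma polynomials_natV m : polynomials (m.+1%:R^-1 : KX C n).
Proof.
exists (mpolyC _ (m.+1%:R^-1)); apply: (mulfI (KX_char0 m)).
rewrite mulfV ?KX_char0 // -(rmorph_nat (@inK C n)) -[RHS]inKM -mpolyC_nat -mpolyCM.
by rewrite mulfV ?C_char0 // mpolyC1 rmorph1.
Qed.

Lemma card_S_eta_gt0 : (0 < #|S_eta eta|)%N.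
Proof.
by apply/card_gt0P; exists 1%g; apply: block_perm1 (@same_block_refl n eta).
Qed.

Lemma B_eta_card : Beta (#|S_eta eta|%:R^-1).
Proof.
apply: B_eta_polynomial; have := polynomials_natV #|S_eta eta|.-1.
by rewrite (prednK card_S_eta_gt0).
Qed.

Lemma sym_eta_scale (v : VK C n) :
  \sum_(s in S_eta eta) permVK s v = #|S_eta eta|%:R *: sym_eta eta v.
Proof.
have G0 : #|S_eta eta|%:R != 0 :> KX C n.
  by have := KX_char0 #|S_eta eta|.-1; rewrite (prednK card_S_eta_gt0).
by rewrite /sym_eta scalerA mulfV // scale1r.
Qed.

Lemma L_eta_word w z : all (simple_transposition eta) w ->
  (forall w', all (simple_transposition eta) w' -> word_perm w' = word_perm w ->
     (size w <= size w')%N) ->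
  L (\sum_(s in S_eta eta) permVK s (pdiff_word w (basisT C z))).
Proof.
move=> aw wmin; rewrite sym_eta_scale; apply: L_etaZ.
  by apply: B_eta_polynomial; exists #|S_eta eta|%:R; rewrite rmorph_nat.
apply: L_eta_DT; exists (word_perm w), w, z; split=> //.
exact: wperm_block (@same_block_refl n eta) (@same_block_sym n eta)
  (@same_block_trans n eta) _ aw.
Qed.

Definition permKXr (s : {perm Sigma n}) : {rmorphism KX C n -> KX C n} := permKX s.

(** A common frame for all generators: [J] indexes the terms of the formula for [E] and [aJ] is the
    action making coefficients and labels equivariant. It is used with positions for the raising and
    lowering operators and with one point for the diagonal ones. *)
Lemma L_eta_stable (J : finType) (P : pred J) (aJ : {perm Sigma n} -> J -> J)
    (c : Zmu0 n -> J -> KX C n) (y : Zmu0 n -> J -> Zmu0 n) (E : VK C n -> VK C n) :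
  (forall f u v, E (f *: u + v) = f *: E u + E v) ->
  (forall z, E (basisT C z) = \sum_(j | P j) c z j *: basisT C (y z j)) ->
  (forall s, s \in S_eta eta -> injective (aJ s) /\ (forall j, P (aJ s j) = P j)) ->
  (forall s z j, s \in S_eta eta -> P j ->
     c (perm_family s z) (aJ s j) = permKX s (c z j) /\
     y (perm_family s z) (aJ s j) = perm_family s (y z j)) ->
  (forall z f j, P j -> polynomials f ->
     (forall s, s \in S_eta eta -> permVK s (basisT C z) = basisT C z ->
        permKX s f = (-1) ^+ s * f) -> Beta (f * c z j)) ->
  forall v, L v -> L (E v).
Proof.
move=> Elin ET aJP eqv Bc.
have EZ := E_scale Elin.
have E0 : E 0 = 0 by have := EZ 0 0; rewrite !scale0r.
have ED u v : E (u + v) = E u + E v by have := Elin 1 u v; rewrite !scale1r.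
(* Equivariance is derived from the formulas: linearity of [E] and semilinearity of the group action
   reduce it to one basis vector. *)
have Epv s u : s \in S_eta eta -> E (permVK s u) = permVK s (E u).
  move=> sG; elim/VK_ind: u => [|u v|f z].
  - by rewrite permVK0 E0 permVK0.
  - exact: commute_add ED (permVKD s).
  apply: (commute_scale f EZ (permVKZ s) (permVK_T C s z)
    (ET (perm_family s z)) (ET z)).
  have [inj PE] := aJP s sG.
  apply: (sum_permuted (permVKD s) (permVKZ s) (permVK_T C s) (permVK0 C s) inj PE).
    by move=> j Pj; have [] := eqv s z j sG Pj.
  by move=> j Pj; have [] := eqv s z j sG Pj.
move=> _ [s [Ls ->]].
apply: (fold_linear ED EZ E0 L_eta0 L_etaD L_etaZ _ Ls) => _ [t [w [z [tG [aw wt wmin] ->]]]].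
rewrite /sym_eta EZ; apply: L_etaZ; first exact: B_eta_card.
apply: (lattice_stable (@same_block_refl n eta) (@same_block_sym n eta)
  (@same_block_trans n eta) (@same_block_pos_inj n eta) (@same_block_convex n eta)
  (pm := permKXr) (@permKX1 C n) (@permKXM C n) (@permKX_x C n)
  (@xK_inj C n) KX_char0
  (@polynomialsB C n) (@polynomialsM C n)
  (fun p => polynomials_inK (xpoly C p)) polynomials_natV
  (@polynomials_perm C n) (@polynomials_diff C n)
  (@permVK1 C n) (@permVKM C n eta) (@permVKD C n) (@permVKZ C n)
  (@B_eta_polynomial C n eta) (@B_eta_split C n eta)
  L_eta0 L_etaD L_etaZ L_eta_word Elin Epv aw (ET z)).
move=> f j Pj Pf anti; exact: Bc.
Qed.

End Lattice.

(** * Generators of the enveloping algebra *)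

Section Enveloping.
Variables (C : fieldType) (U : algType C) (P : U -> Prop).
Hypothesis P1 : P 1.
Hypothesis P_lin : forall c u v, P u -> P v -> P (c *: u + v).
Hypothesis PM : forall u v, P u -> P v -> P (u * v).

(** Classical logic makes the predicate boolean, so that its elements form an algebra type to which
    the universal property can be applied. *)
Definition subalg_pred : {pred U} := fun u => `[< P u >].

Fact subalg_pred_closed : subalg_closed subalg_pred.
Proof.
split; first exact/asboolP.
  by move=> c u v /asboolP Pu /asboolP Pv; apply/asboolP/P_lin.
by move=> u v /asboolP Pu /asboolP Pv; apply/asboolP/PM.
Qed.

HB.instance Definition _ := GRing.isSubalgClosed.Build C U subalg_pred subalg_pred_closed.

Record subalg := Subalg { subalg_val : U; _ : subalg_val \in subalg_pred }.
HB.instance Definition _ := [isSub for subalg_val].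
HB.instance Definition _ := [Choice of subalg by <:].
HB.instance Definition _ := [SubChoice_isSubAlgebra of subalg by <:].

Variables (n : nat) (iota : {linear 'M[C]_n -> U}).
Hypothesis iota_univ : is_universal_enveloping iota.

(* The universal map into the subalgebra cut out by P, followed by the
   inclusion, is the identity by uniqueness. *)
Section Factorization.
Hypothesis P_iota : forall M, P (iota M).

Let iota_sub (M : 'M[C]_n) : subalg := Subalg (introT (asboolP (P (iota M))) (P_iota M)).

Fact iota_sub_linear : linear iota_sub.
Proof. by move=> c M N; apply: val_inj; rewrite /= linearP. Qed.

HB.instance Definition _ :=
  GRing.isLinear.Build C 'M[C]_n subalg _ iota_sub iota_sub_linear.

Let incl_h (h : {lrmorphism U -> subalg}) (u : U) : U := subalg_val (h u).

Fact incl_h_monoid h : monoid_morphism (incl_h h).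
Proof. by split=> [|u v]; rewrite /incl_h ?rmorph1 ?rmorphM. Qed.

Fact incl_h_linear h : linear (incl_h h).
Proof. by move=> c u v; rewrite /incl_h linearP. Qed.

HB.instance Definition _ h :=
  GRing.isLinear.Build C U U _ (incl_h h) (incl_h_linear h).
HB.instance Definition _ h :=
  GRing.isMonoidMorphism.Build U U (incl_h h) (incl_h_monoid h).

Lemma enveloping_generated u : P u.
Proof.
have [lie univ] := iota_univ.
have [|h [hE _]] := univ subalg iota_sub.
  by move=> M N; apply: val_inj; rewrite /= lie.
have [g [_ g_uniq]] := univ U iota lie.
have e1 : incl_h h =1 g by apply: g_uniq => M; rewrite /= /incl_h hE.
have e2 : (idfun : {lrmorphism U -> U}) =1 g by apply: g_uniq.
rewrite -[u]/(idfun u) e2 -e1 /incl_h.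
exact: asboolP (valP (h u)).
Qed.

End Factorization.

Let PB u v : P u -> P v -> P (u - v).
Proof. by move=> Pu Pv; rewrite addrC -scaleN1r; apply: P_lin. Qed.

(** For i != j the matrix unit E_ij is the commutator of E_im and E_mj, and [iota] turns it into a
    commutator in U. Induction on the distance of the indices starts from neighbours. *)
Lemma enveloping_chevalley_generated :
  (forall k l : 'I_n, l = k.+1 :> nat ->
     P (iota (delta_mx k l)) /\ P (iota (delta_mx l k))) ->
  (forall k, P (iota (delta_mx k k))) -> forall u, P u.
Proof.
move=> Pkl Pkk; have [lie _] := iota_univ.
have Plie i m j : i != j -> P (iota (delta_mx i m)) -> P (iota (delta_mx m j)) ->
    P (iota (delta_mx i j)).
  move=> ij Pim Pmj.
  have -> : (delta_mx i j : 'M[C]_n) = delta_mx i m *m delta_mx m j - delta_mx m j *m delta_mx i m.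
    by rewrite mul_delta_mx mul_delta_mx_0 ?subr0 // eq_sym.
  by rewrite lie; apply: PB; apply: PM.
have Pij d : forall i j : 'I_n, (j = i + d.+1 :> nat)%N ->
    P (iota (delta_mx i j)) /\ P (iota (delta_mx j i)).
  elim: d => [|d IH] i j e; first by apply: Pkl; rewrite e addn1.
  have mn : (i + d.+1 < n)%N.
    by apply: leq_ltn_trans (ltn_ord j); rewrite e leq_add2l.
  have [P1' P2'] := IH i (Ordinal mn) erefl.
  have [|P3 P4] := Pkl (Ordinal mn) j; first by rewrite /= e addnS.
  have ij : i != j.
    by apply/eqP => /(congr1 val) /= e2; move: e; rewrite e2; lia.
  by split; [apply: Plie P1' P3 | apply: Plie P4 P2'; rewrite // eq_sym].
apply: enveloping_generated => M; rewrite (matrix_sum_delta M) linear_sum.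
have P0 : P 0 by rewrite -(subrr 1); apply: PB.
have PD u v : P u -> P v -> P (u + v).
  by move=> Pu Pv; rewrite -[u]scale1r; apply: P_lin.
apply: (big_ind P) => // i _; rewrite linear_sum; apply: (big_ind P) => // j _.
rewrite -[iota _]addr0 linearZ; apply: P_lin => //.
have [lt|gt|e] := ltngtP i j; last by rewrite (val_inj e).
  by have [|] := Pij (j - i).-1 i j; first by lia.
by have [|] := Pij (i - j).-1 j i; first by lia.
Qed.

End Enveloping.

(** * Stability under the Chevalley generators *)

Section Operators.
Variables (C : fieldType) (n : nat) (eta : 'I_n -> seq nat).
Hypothesis C_char0 : forall m, m.+1%:R != 0 :> C.
Local Notation V := (VK C n).
Local Notation L := (@L_eta C n eta).
Variable E : V -> V.
Hypothesis E_lin : forall f u v, E (f *: u + v) = f *: E u + E v.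

Lemma top_zero_add (z : Zmu0 n) (d : {ffun Sigma n -> int}) p :
  ((row_of p).+1 < n)%N -> (forall q, q != p -> d q = 0) ->
  top_zero (\val z + d).
Proof.
move=> lt d0; apply/top_zeroP => q e.
rewrite ffunE (top_zeroP _ (valP z) _ e) add0r d0 //.
by apply: contraTneq lt => <-; rewrite e ltnn.
Qed.

Lemma perm_family_add s (z : Zmu0 n) (d d' : {ffun Sigma n -> int}) p :
  s \in S_eta eta -> ((row_of p).+1 < n)%N -> (forall q, q != p -> d q = 0) ->
  (forall q, d' (s q) = d q) ->
  to_Zmu0 (\val (perm_family s z) + d') = perm_family s (to_Zmu0 (\val z + d)).
Proof.
move=> sG lt d0 dd'; apply/esym.
apply: (perm_family_to_Zmu0 sG); first exact: top_zero_add lt d0.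
move=> q; rewrite !ffunE (val_perm_family _ _ sG) -dd'.
by rewrite permKV.
Qed.

(** Raising and lowering operators together: [b] is the sign, [P] selects the neighbouring row in
    the numerator and [d] is the shift of the label. The bound on k keeps p off the top row, so
    shifted labels remain in [Zmu0] and the differences inverted in [B_eta] are available. *)
Lemma L_eta_stable_root (k : 'I_n) (P : Sigma n -> pred (Sigma n))
    (b : KX C n) (d : Sigma n -> {ffun Sigma n -> int}) :
  (k.+1 < n)%N -> polynomials b -> (forall s, permKX s b = b) ->
  (forall s p q, s \in S_eta eta -> P (s p) (s q) = P p q) ->
  (forall p q, q != p -> d p q = 0) ->
  (forall (s : {perm Sigma n}) p q, d (s p) (s q) = d p q) ->
  (forall z, E (basisT C z) = \sum_(p : Sigma n | row_of p == k)
     (b * shiftKX z ((\prod_(q | P p q) (xK C p - xK C q)) /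
       (\prod_(q | (row_of q == row_of p) && (q != p)) (xK C p - xK C q))))
     *: basisT C (to_Zmu0 (\val z + d p))) ->
  forall v, L v -> L (E v).
Proof.
move=> kn Pb bs Ps d0 ds ET; apply: (L_eta_stable C_char0 (aJ := fun s p => s p) E_lin ET).
- by move=> s sG; split=> [|p]; [exact: perm_inj | rewrite (S_eta_row _ sG)].
- move=> s z p sG /eqP rp; split; last first.
    by apply: (perm_family_add (p := p) z sG _ (d0 p)); rewrite ?rp.
  rewrite permKX_mul bs -(shiftKX_permKX _ _ sG).
  congr (b * shiftKX _ _).
  rewrite (fmorph_div (permKX s)) /= !(rmorph_prod (permKX s)) /=.
  congr (_ / _); rewrite (reindex_inj (@perm_inj _ s)) /=; apply: eq_big => q.
  + exact: Ps.
  + by rewrite (rmorphB (permKX s)) /= !permKX_x.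
  + by rewrite !(S_eta_row _ sG) (inj_eq perm_inj).
  + by rewrite (rmorphB (permKX s)) /= !permKX_x.
move=> z f p /eqP rp Pf anti; rewrite shiftKX_prod_div [b * _]mulrA.
apply: (B_eta_antisymmetric C_char0 _ Pf _ anti); first by rewrite rp.
by apply: polynomialsM => //; apply: polynomials_prod_shift.
Qed.

Lemma L_eta_stable_diagonal (c : Zmu0 n -> KX C n) :
  (forall z, polynomials (c z)) ->
  (forall s z, s \in S_eta eta -> c (perm_family s z) = permKX s (c z)) ->
  (forall z, E (basisT C z) = c z *: basisT C z) ->
  forall v, L v -> L (E v).
Proof.
move=> Pc cs ET; apply: (L_eta_stable C_char0 (J := unit) (P := predT)
  (aJ := fun _ => id) (c := fun z _ => c z) (y := fun z _ => z) E_lin).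
- by move=> z; rewrite ET (big_pred1 tt) //; case.
- by move=> s _; split=> // i j.
- by move=> s z j sG _; rewrite cs.
- by move=> z f j _ Pf _; apply: B_eta_polynomial; apply: polynomialsM.
Qed.

End Operators.

Section RowSums.
Variables (C : fieldType) (n : nat) (eta : 'I_n -> seq nat).

Lemma polynomials_nat m : polynomials (m%:R : KX C n).
Proof. by exists m%:R; rewrite rmorph_nat. Qed.

Lemma polynomials_sum_shift (z : Zmu0 n) (P : pred (Sigma n)) :
  polynomials (\sum_(p | P p) (xK C p + (\val z p)%:~R)).
Proof.
apply: (big_ind (@polynomials C n)) => [||p _]; first exact: (polynomials_nat 0).
  exact: polynomialsD.
by apply: polynomialsD (polynomials_int _ _ _); apply: polynomials_inK.
Qed.

Lemma sum_shift_perm s (z : Zmu0 n) (P : pred (Sigma n)) : s \in S_eta eta ->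
  (forall p, P (s p) = P p) ->
  \sum_(p | P p) (xK C p + (\val (perm_family s z) p)%:~R) =
  permKX s (\sum_(p | P p) (xK C p + (\val z p)%:~R)).
Proof.
move=> sG Ps; rewrite (rmorph_sum (permKX s)) /= (reindex_inj (@perm_inj _ s)) /=.
apply: eq_big => [//|p _]; rewrite (rmorphD (permKX s)) /= permKX_x.
by rewrite (rmorph_int (permKX s)) (val_perm_family _ _ sG) permK.
Qed.

End RowSums.

Theorem theorem5p3 (R : realType) (n : nat) (hn : (0 < n)%N)
    (U : algType (complex R)) (iota : {linear 'M[complex R]_n -> U})
    (hU : is_universal_enveloping iota)
    (act : U -> VK (complex R) n -> VK (complex R) n)
    (hact : is_Klinear_module act)
    (hGT : gelfand_tsetlin_formulas iota act)
    (eta : 'I_n -> seq nat) (heta : is_refinement eta)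
    (hdecr : forall k : 'I_n, (k.+1 < n)%N -> sorted geq (eta k))
    (htop : forall k : 'I_n, k.+1 = n -> eta k = nseq n 1%N) :
  is_submodule act (@L_eta (complex R) n eta).
Proof.
have C_char0 m : m.+1%:R != 0 :> complex R by rewrite Num.Theory.pnatr_eq0.
split; [exact: L_eta0 | exact: L_etaD | move=> u].
have [act_lin act_comb act_one act_mul] := hact.
have [act_up act_down act_diag] := hGT.
have E_lin w : forall f v v', act w (f *: v + v') = f *: act w v + act w v'.
  by move=> f v v'; apply: act_lin.
have delta0 (p q : Sigma n) : q != p -> delta_family p q = 0.
  by move=> /negPf h; rewrite ffunE h.
have deltas (s : {perm Sigma n}) p q : delta_family (s p) (s q) = delta_family p q.
  by rewrite !ffunE (inj_eq perm_inj).
have P1 : polynomials (1 : KX (complex R) n) by exists 1; rewrite rmorph1.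
(* The elements preserving the lattice form a subalgebra, so generators suffice; complex scalars are
   harmless since constants lie in [B_eta]. *)
pose P w := forall v, L_eta eta v -> L_eta eta (act w v).
suff : P u by [].
apply: (enveloping_chevalley_generated (P := P) _ _ _ hU).
- by move=> v; rewrite act_one.
- move=> c w w' Pw Pw' v Lv; rewrite act_comb; apply: L_etaD; last exact: Pw'.
  by apply: L_etaZ; [apply/B_eta_polynomial/polynomials_C | apply: Pw].
- by move=> w w' Pw Pw' v Lv; rewrite act_mul; apply/Pw/Pw'.
(* Both operators between k and l = k + 1 shift row k only, and the existence of l shows that this
   row is not the top one. *)
- move=> k l kl; have kn : (k.+1 < n)%N by rewrite -kl.
  split.
  + apply: (L_eta_stable_root C_char0 (E_lin _) (b := - 1)
      (P := fun p q => row_of q == (row_of p).+1 :> nat)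
      (d := fun p => delta_family p) kn) => //.
    * by exists (- 1); rewrite rmorphN1.
    * by move=> s; rewrite (rmorphN1 (permKX s)).
    * by move=> s p q sG; rewrite !(S_eta_row _ sG).
    * move=> z; rewrite (act_up k l z kl) -sumrN; apply: eq_bigr => p _.
      by rewrite mulN1r scaleNr.
  + apply: (L_eta_stable_root C_char0 (E_lin _) (b := 1)
      (P := fun p q => (row_of q).+1 == row_of p :> nat)
      (d := fun p => - delta_family p) kn) => //.
    * by move=> s; rewrite (rmorph1 (permKX s)).
    * by move=> s p q sG; rewrite !(S_eta_row _ sG).
    * by move=> p q qp; rewrite ffunE delta0 // oppr0.
    * by move=> s p q; rewrite [LHS]ffunE [RHS]ffunE deltas.
    * move=> z; rewrite (act_down k l z kl); apply: eq_bigr => p _.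
      by rewrite mul1r.
- move=> k; apply: (L_eta_stable_diagonal C_char0 (E_lin _) _ _ (act_diag k)).
  + move=> z; apply: polynomialsD (polynomials_nat _ _ _).
    by apply: polynomialsB; apply: polynomials_sum_shift.
  + move=> s z sG; rewrite !(sum_shift_perm _ _ sG) => [|p|p]; try by rewrite (S_eta_row _ sG).
    by rewrite (rmorphD (permKX s)) (rmorphB (permKX s)) (rmorph_nat (permKX s)).
Qed.
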